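(* Let $V$ be a $\mathbb Z_2$-graded complex vector space of superdimension $(m|n)$, let $U=V\otimes_{\mathbb C}\Lambda$ with $\Lambda$ the infinite-dimensional Grassmann algebra, and let $W=\bigoplus_{i=1}^sU_1^1$ with $s\in\mathbb N$. Let $(m_1,\dots,m_s)$ be non-negative integers, $r=N=\sum_im_i$, and $\sigma\in\mathfrak S_N$. Then the graded picture invariant $\varphi_\sigma\in S^{(m_1,\dots,m_s)}(W^* )$ is mapped by the restitution map $F^r$ to the trace monomial function $$F^r(\varphi_\sigma)(u_1,\dots,u_s)=\operatorname{tr}_\sigma\big(\underbrace{u_1\otimes\cdots\otimes u_1}_{m_1}\otimes\cdots\otimes\underbrace{u_s\otimes\cdots\otimes u_s}_{m_s}\big)$$ for all $(u_1,\dots,u_s)\in W_0$.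
   Context: **Setting.** $\Lambda=\varinjlim\Lambda(k)$ is the complex Grassmann (exterior) algebra on countably many generators, with its $\mathbb Z_2$-grading; one-sided $\Lambda$-modules are bimodules by supercommutativity. $V=V_0\oplus V_1$ has a basis $e_1,\dots,e_{m+n}$, with the first $m$ vectors even and the last $n$ odd, and dual basis $e_1^*,\dots,e_{m+n}^*$, also regarded as $\Lambda$-bases of $U$ and $U^*=\operatorname{Hom}_\Lambda(U,\Lambda)$. All tensor products of $\Lambda$-modules are over $\Lambda$; $|x|$ is the parity of $x$. $U_1^1:=U\otimes U^*$, identified with $\operatorname{End}_\Lambda(U)$ via $(v\otimes\phi)(w)=v\phi(w)$. $W_0$ is the even part of $W$. **Supersymmetric algebra.** $T^r(W^* )=(W^* )^{\otimes r}$ and $S(W^* )=T(W^* )/I(W^* )$, where $I(W^* )$ is generated by $u\otimes v-(-1)^{|u||v|}v\otimes u$ for homogeneous $u,v\in W^*$. $\varpi_r:T^r(W^* )\to S^r(W^* )$ is the quotient map. $T(i)_l^u\in W^*$ ($1\le i\le s$, $1\le l,u\le m+n$) is the dual basis element which, on the $i$-th summand $U_1^1$, is $1$ on $e_l\otimes e_u^*$ and $0$ on the other standard basis vectors, and which is $0$ on the other summands. It has multidegree the $i$-th unit vector of $\mathbb Z^s$, and $S^{(m_1,\dots,m_s)}(W^* )$ is the multidegree $(m_1,\dots,m_s)$ component of $S^r(W^* )$. **Restitution.** The evaluation $ev:T^r(W^* )\otimes T^r(W)\to\Lambda$ is $ev(f_1\otimes\cdots\otimes f_r\otimes w_1\otimes\cdots\otimes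 w_r)=(-1)^pf_1(w_1)\cdots f_r(w_r)$, $p=\sum_j|w_j|(|f_{j+1}|+\cdots+|f_r|)$, for homogeneous $f_j,w_j$. For $f\in S^r(W^* )$, $F^r(f):W_0\to\Lambda$ is the function $F^r(f)(w)=ev(\boldsymbol f\otimes w\otimes\cdots\otimes w)$, where $\boldsymbol f\in T^r(W^* )$ is any element with $\varpi_r(\boldsymbol f)=f$ (independent of the choice). **Graded picture invariants (case $b_i=t_i=1$).** For $1\le k\le N$ let $i_k$ be the unique index with $\sum_{p<i_k}m_p<k\le\sum_{p\le i_k}m_p$. Then $$\varphi_\sigma=\sum_{r_1,\dots,r_N\in\{1,\dots,m+n\}}\gamma\,(-1)^q\;T(i_1)_{r_{\sigma(1)}}^{r_1}T(i_2)_{r_{\sigma(2)}}^{r_2}\cdots T(i_N)_{r_{\sigma(N)}}^{r_N}\in S(W^* ),$$ where, with $a_k$ the parity of $e_{r_k}$, $$\gamma=\prod_{\substack{1\le k<l\le N\\\sigma(k)>\sigma(l)}}(-1)^{a_{\sigma(k)}a_{\sigma(l)}},\qquad q=\sum_{k=1}^Na_{\sigma(k)}\Big(\sum_{l<k}a_l\Big)+\sum_{k=1}^Na_k+\sum_{1\le k<l\le N}a_ka_l+\sum_{1\le k<l\le N}(a_{\sigma(k)}+a_k)(a_{\sigma(l)}+a_l).$$ **Trace monomials.** The supertrace is $\operatorname{str}:\operatorname{End}_\Lambda(U)\cong U\otimes U^*\to\Lambda$, $\operatorname{str}(v\otimes\phi)=(-1)^{|v||\phi|}\phi(v)$. For $\sigma\in\mathfrak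 S_N$ with cycle decomposition $\sigma^{-1}=(i_1\,i_2\cdots i_p)(j_1\,j_2\cdots j_q)\cdots$ (including 1-cycles) and $A_1,\dots,A_N\in U_1^1$, $$\operatorname{tr}_\sigma(A_1\otimes\cdots\otimes A_N)=\operatorname{str}(A_{i_1}A_{i_2}\cdots A_{i_p})\,\operatorname{str}(A_{j_1}A_{j_2}\cdots A_{j_q})\cdots,$$ the product in $U_1^1$ being $(v\otimes\alpha)(w\otimes\beta)=v\,\alpha(w)\otimes\beta$, i.e. composition. On even elements $A_k$ this does not depend on how the cycle decomposition is written. *)

(* Defs.v *)
From HB Require Import structures.
From mathcomp Require Import all_boot all_order all_algebra all_fingroup.
From mathcomp Require Import ring finmap monalg.
From mathcomp Require Import boolp reals complex.

Set Implicit Arguments.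
Unset Strict Implicit.
Unset Printing Implicit Defensive.

Import GRing.Theory Num.Theory.
Local Open Scope ring_scope.

(* Lambda has basis the monomials xi_A = xi_(a_1) ... xi_(a_k), for A the
   finite set of generators a_1 < ... < a_k. *)
Definition grassmann (C : comNzRingType) : Type := {malg C[{fset nat}]}.

HB.instance Definition _ (C : comNzRingType) := GRing.Zmodule.on (grassmann C).

Definition inversions (A B : {fset nat}) : nat :=
  (\sum_(a <- A) \sum_(b <- B) (b < a)%N)%N.

(* xi_A * xi_B = gsign A B * xi_(A `|` B) *)
Definition gsign (C : comNzRingType) (A B : {fset nat}) : C :=
  if [disjoint A & B]%fset then (-1) ^+ inversions A B else 0.

HB.lock Definition gmul (C : comNzRingType) (x y : grassmann C) : grassmann C :=
  \sum_(A <- msupp x) \sum_(B <- msupp y)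
    << x@_A * y@_B * gsign C A B *g (A `|` B)%fset >>.

Arguments gmul {C} x y.

Section Grassmann.
Variable C : comNzRingType.

Local Notation Lam := (grassmann C).
Implicit Types (A B D : {fset nat}) (x y z : Lam) (c d : bool) (k n : nat).

Local Notation gsign := (gsign C).

Definition gone : Lam := << fset0 >>.

Lemma gmulw (d1 d2 : {fset {fset nat}}) x y :
  (msupp x `<=` d1)%fset -> (msupp y `<=` d2)%fset ->
  gmul x y = \sum_(A <- d1) \sum_(B <- d2)
    << x@_A * y@_B * gsign A B *g (A `|` B)%fset >>.
Proof.
move=> le1 le2; rewrite gmul.unlock (big_fset_incl _ le1) /=.
  apply/eq_bigr=> A _; apply/big_fset_incl => // B _ /mcoeff_outdom ->.
  by rewrite mulr0 mul0r monalgU0.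
move=> A _ /mcoeff_outdom xA; rewrite big1 // => B _.
by rewrite xA !mul0r monalgU0.
Qed.

Lemma gmulUU (a b : C) A B :
  gmul << a *g A >> << b *g B >> = << a * b * gsign A B *g (A `|` B)%fset >>.
Proof. by rewrite (gmulw msuppU_le msuppU_le) !big_seq_fset1 !mcoeffUU. Qed.

Lemma gmulDl : left_distributive (@gmul C) +%R.
Proof.
move=> x y z.
rewrite [gmul x z](gmulw (fsubsetUl _ (msupp y)) (fsubset_refl _)).
rewrite [gmul y z](gmulw (fsubsetUr (msupp x) _) (fsubset_refl _)).
rewrite (gmulw (msuppD_le _ _) (fsubset_refl _)) -big_split /=.
apply/eq_bigr=> A _; rewrite -big_split /=; apply/eq_bigr=> B _.
by rewrite mcoeffD !mulrDl monalgUD.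
Qed.

Lemma gmulDr : right_distributive (@gmul C) +%R.
Proof.
move=> z x y.
rewrite [gmul z x](gmulw (fsubset_refl _) (fsubsetUl _ (msupp y))).
rewrite [gmul z y](gmulw (fsubset_refl _) (fsubsetUr (msupp x) _)).
rewrite (gmulw (fsubset_refl _) (msuppD_le _ _)) -big_split /=.
apply/eq_bigr=> A _; rewrite -big_split /=; apply/eq_bigr=> B _.
by rewrite mcoeffD mulrDr mulrDl monalgUD.
Qed.

Lemma gmul0l : left_zero 0 (@gmul C).
Proof. by move=> x; rewrite gmul.unlock msupp0 big_seq_fset0. Qed.

Lemma gmul0r : right_zero 0 (@gmul C).
Proof.
by move=> x; rewrite gmul.unlock big1 // => A _; rewrite msupp0 big_seq_fset0.
Qed.

Lemma gmul_suml I (r : seq I) (F : I -> Lam) y :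
  gmul (\sum_(i <- r) F i) y = \sum_(i <- r) gmul (F i) y.
Proof. exact: (big_morph (gmul^~ y) (fun u v => gmulDl u v y) (gmul0l y)). Qed.

Lemma gmul_sumr I (r : seq I) (F : I -> Lam) y :
  gmul y (\sum_(i <- r) F i) = \sum_(i <- r) gmul y (F i).
Proof. exact: (big_morph (gmul y) (gmulDr y) (gmul0r y)). Qed.

Lemma gsign0l A : gsign fset0 A = 1.
Proof.
by rewrite /gsign /inversions fdisjoint0X big_seq_fset0.
Qed.

Lemma gsign0r A : gsign A fset0 = 1.
Proof.
by rewrite /gsign /inversions fdisjointX0 big1 // => a _; rewrite big_seq_fset0.
Qed.

Lemma big_fsetU_disj A B (F : nat -> nat) : [disjoint A & B]%fset ->
  (\sum_(a <- (A `|` B)%fset) F a = \sum_(a <- A) F a + \sum_(a <- B) F a)%N.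
Proof.
move=> dAB; rewrite -big_cat; apply: perm_big.
apply: uniq_perm; rewrite ?fset_uniq // ?cat_uniq ?fset_uniq /= ?andbT.
  apply/hasPn => b bB; apply/negP => bA.
  by move/fdisjointP: dAB => /(_ b bA); rewrite bB.
by move=> a; rewrite mem_cat in_fsetU.
Qed.

Lemma inversionsUl A B D : [disjoint A & B]%fset ->
  inversions (A `|` B)%fset D = (inversions A D + inversions B D)%N.
Proof.
move=> dAB; rewrite /inversions.
exact: big_fsetU_disj.
Qed.

Lemma inversionsUr A B D : [disjoint A & B]%fset ->
  inversions D (A `|` B)%fset = (inversions D A + inversions D B)%N.
Proof.
move=> dAB; rewrite /inversions -big_split /=; apply: eq_bigr => a _.
exact: big_fsetU_disj.
Qed.

Lemma gsignA A B D :
  gsign A B * gsign (A `|` B)%fset D = gsign B D * gsign A (B `|` D)%fset.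
Proof.
rewrite /gsign fdisjointXU fdisjointUX.
case dAB: [disjoint A & B]%fset; case dBD: [disjoint B & D]%fset;
  case dAD: [disjoint A & D]%fset; rewrite ?(mul0r, mulr0) //=.
by rewrite -!exprD inversionsUl // inversionsUr //; congr (_ ^+ _); ring.
Qed.

Lemma gmulA : associative (@gmul C).
Proof.
move=> x y z.
rewrite (monalgE x) gmul_suml [X in _ = gmul X _]gmul_suml gmul_suml; apply: eq_bigr => A _.
rewrite (monalgE y) gmul_suml gmul_sumr [X in _ = gmul X _]gmul_sumr gmul_suml; apply: eq_bigr => B _.
rewrite (monalgE z) [X in gmul _ X = _]gmul_sumr !gmul_sumr; apply: eq_bigr => D _.
rewrite !gmulUU fsetUA; congr mkmalgU.
by rewrite -!mulrA; congr (_ * (_ * _)); rewrite [RHS]mulrCA gsignA.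
Qed.

Lemma gmul1l : left_id gone (@gmul C).
Proof.
move=> x; rewrite [in RHS](monalgE x) [x in gmul _ x](monalgE x) gmul_sumr.
by apply: eq_bigr => A _; rewrite gmulUU gsign0l mulr1 mul1r fset0U.
Qed.

Lemma gmul1r : right_id gone (@gmul C).
Proof.
move=> x; rewrite [in RHS](monalgE x) [x in gmul x _](monalgE x) gmul_suml.
by apply: eq_bigr => A _; rewrite gmulUU gsign0r !mulr1 fsetU0.
Qed.

Lemma gone_neq0 : gone != 0.
Proof. by rewrite monalgU_eq0 oner_eq0. Qed.

HB.instance Definition _ := GRing.Zmodule_isNzRing.Build Lam
  gmulA gmul1l gmul1r gmulDl gmulDr gone_neq0.

Lemma gmulE x y : x * y = gmul x y. Proof. by []. Qed.

(* x is homogeneous of parity d. *)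
Definition ghom d x : bool := all (fun A => odd #|` A| == d) (msupp x).

(* The n-th power of the grading automorphism x |-> (-1)^|x| x. *)
Definition gtwist n x : Lam :=
  [malg A in msupp x => (-1) ^+ (n * #|` A|) * x@_A].

Lemma gtwistE n x A : (gtwist n x)@_A = (-1) ^+ (n * #|` A|) * x@_A.
Proof.
rewrite mcoeffE; case: ifP => // /negbT /mcoeff_outdom ->.
by rewrite mulr0.
Qed.

Lemma ghomP d x : reflect (forall A, odd #|` A| != d -> x@_A = 0) (ghom d x).
Proof.
apply: (iffP allP) => h A hA.
  by apply: mcoeff_outdom; apply: contra hA => /h.
by apply: contraLR hA => /h/eqP; rewrite mcoeff_eq0.
Qed.

Lemma ghom_supp d x A : ghom d x -> A \in msupp x -> odd #|` A| = d.
Proof. by move=> /allP h /h /eqP. Qed.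

Lemma ghom0 d : ghom d 0.
Proof. by apply/ghomP => A _; rewrite mcoeff0. Qed.

Lemma ghomD d x y : ghom d x -> ghom d y -> ghom d (x + y).
Proof.
move=> /ghomP hx /ghomP hy; apply/ghomP => A hA.
by rewrite mcoeffD hx // hy // addr0.
Qed.

Lemma ghomN d x : ghom d x -> ghom d (- x).
Proof. by move=> /ghomP hx; apply/ghomP => A hA; rewrite mcoeffN hx // oppr0. Qed.

Lemma ghom_sum d I (r : seq I) (P : pred I) (F : I -> Lam) :
  (forall i, P i -> ghom d (F i)) -> ghom d (\sum_(i <- r | P i) F i).
Proof.
by move=> h; elim/big_ind: _ => //; [exact: ghom0 | move=> *; exact: ghomD].
Qed.

Lemma ghomU (a : C) A : ghom (odd #|` A|) << a *g A >>.
Proof. by apply/ghomP => B nB; rewrite mcoeffU; case: (eqVneq A B) nB => [->|//]; rewrite eqxx. Qed.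

Lemma ghom1 : ghom false 1.
Proof. by have := ghomU 1 fset0; rewrite cardfs0. Qed.

Lemma ghomM c d x y : ghom c x -> ghom d y -> ghom (c (+) d) (x * y).
Proof.
move=> hx hy; rewrite gmulE gmul.unlock [X in ghom _ X]big_seq.
apply: ghom_sum => A hA; rewrite big_seq; apply: ghom_sum => B hB.
case dAB: [disjoint A & B]%fset; last first.
  by rewrite /gsign dAB mulr0 monalgU0 ghom0.
have <- : odd #|` (A `|` B)%fset| = c (+) d; last exact: ghomU.
rewrite cardfsU; move: dAB; rewrite /fdisjoint => /eqP ->.
by rewrite cardfs0 subn0 oddD (ghom_supp hx hA) (ghom_supp hy hB).
Qed.

Lemma ghom_signr d n x : ghom d x -> ghom d ((-1) ^+ n * x).
Proof. by move=> h; rewrite -signr_odd; case: odd; rewrite ?(mul1r, mulN1r) // ghomN. Qed.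

Lemma gsignC A B :
  gsign B A = (-1) ^+ (#|` A| * #|` B|) * gsign A B.
Proof.
rewrite /gsign fdisjoint_sym; case dAB: [disjoint A & B]%fset; last by rewrite mulr0.
suff -> : (#|` A| * #|` B|)%N = (inversions A B + inversions B A)%N.
  by rewrite addnC exprD -mulrA -exprD addnn -[(-1) ^+ _.*2]signr_odd odd_double mulr1.
rewrite {2}/inversions exchange_big /= /inversions -big_split /=.
rewrite big_seq (eq_bigr (fun=> #|` B|)); last first.
  move=> a aA; rewrite -big_split /= big_seq (eq_bigr (fun=> 1%N)).
    by rewrite -big_seq big_const_seq count_predT iter_addn_0 mul1n.
  move=> b bB; case: ltngtP => // eab.
  by move/fdisjointP: dAB => /(_ a aA); rewrite -eab bB.
by rewrite -big_seq big_const_seq count_predT iter_addn_0 mulnC.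
Qed.

Lemma gtwist_hom n d x : ghom d x -> gtwist n x = (-1) ^+ (n * d) * x.
Proof.
move=> hx; apply/malgP => A; rewrite gtwistE.
have -> : ((-1) ^+ (n * d) * x)@_A = (-1) ^+ (n * d) * x@_A.
  rewrite -signr_odd -[in RHS]signr_odd.
  by case: odd; rewrite ?(expr0, expr1, mul1r, mulN1r) ?mcoeffN.
have [e|ne] := eqVneq (odd #|` A|) d; last by rewrite (ghomP _ _ hx) // !mulr0.
by rewrite -signr_odd -[in RHS]signr_odd !oddM e oddb.
Qed.

Lemma ghom_twist n d x : ghom d x -> ghom d (gtwist n x).
Proof. by move=> h; rewrite (gtwist_hom n h) ghom_signr. Qed.

Lemma gmulC c d x y : ghom c x -> ghom d y -> y * x = (-1) ^+ (c * d) * (x * y).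
Proof.
move=> hx hy.
rewrite (gmulE y x) (gmulE x y) gmul.unlock [LHS]exchange_big /= mulr_sumr.
rewrite big_seq [RHS]big_seq; apply: eq_bigr => A hA.
rewrite mulr_sumr big_seq [RHS]big_seq; apply: eq_bigr => B hB.
rewrite gsignC fsetUC [y@_B * _]mulrC mulrCA.
rewrite -signr_odd -[in RHS]signr_odd !oddM !oddb.
rewrite (ghom_supp hx hA) (ghom_supp hy hB).
by case: (c && d); rewrite ?(expr0, expr1, mul1r, mulN1r) // monalgUN.
Qed.

Lemma gtwistD n : {morph gtwist n : x y / x + y}.
Proof. by move=> x y; apply/malgP => A; rewrite !(mcoeffD, gtwistE) mulrDr. Qed.

Lemma gtwist0 n : gtwist n 0 = 0.
Proof. by apply/malgP => A; rewrite gtwistE !mcoeff0 mulr0. Qed.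

Lemma gtwistM n : {morph gtwist n : x y / x * y}.
Proof.
have tw_sum I (r : seq I) (F : I -> Lam) :
    gtwist n (\sum_(i <- r) F i) = \sum_(i <- r) gtwist n (F i).
  exact: (big_morph (gtwist n) (gtwistD n) (gtwist0 n)).
have twU (a : C) A :
    gtwist n << a *g A >> = (-1) ^+ (n * odd #|` A|) * (<< a *g A >> : Lam).
  exact/gtwist_hom/ghomU.
move=> x y; rewrite (monalgE x) (monalgE y) mulr_suml !tw_sum mulr_suml.
apply: eq_bigr => A _; rewrite mulr_sumr tw_sum mulr_sumr; apply: eq_bigr => B _.
have hA := ghomU x@_A A; have hB := ghomU y@_B B.
rewrite !twU; move: (<< x@_A *g A >> : Lam) (<< y@_B *g B >> : Lam) hA hB => u v hu hv.
rewrite (gtwist_hom n (ghomM hu hv)).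
rewrite -(mulrA _ u) (mulrA u) (commr_sign u) -(mulrA _ u) mulrA -exprD -mulnDr.
congr (_ * _); rewrite -signr_odd -[in RHS]signr_odd !oddM !oddD !oddb.
by case: (odd #|` A|); case: (odd #|` B|).
Qed.

End Grassmann.

Section GrassmannProducts.
Variable C : comNzRingType.
Local Notation Lam := (grassmann C).

Lemma signr_eq_odd (R : pzRingType) (j k : nat) :
  odd j = odd k -> (-1) ^+ j = (-1) ^+ k :> R.
Proof. by move=> e; rewrite -signr_odd e signr_odd. Qed.

Lemma odd_sum I (s : seq I) (P : pred I) (F G : I -> nat) :
  (forall i, P i -> odd (F i) = odd (G i)) ->
  odd (\sum_(i <- s | P i) F i) = odd (\sum_(i <- s | P i) G i).
Proof.
move=> h; elim/big_rec2: _ => // i a b Pi e.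
by rewrite !oddD h // e.
Qed.

Lemma ghom_prod r (a : 'I_r -> Lam) (al : 'I_r -> bool) :
  (forall k, ghom (al k) (a k)) -> ghom (odd (\sum_k al k)) (\prod_k a k).
Proof.
elim: r a al => [|r IH] a al h; first by rewrite !big_ord0 ghom1.
by rewrite !big_ord_recl oddD oddb ghomM // IH // => k; exact: h.
Qed.

Lemma prod_signr r (e : 'I_r -> nat) (G : 'I_r -> Lam) :
  \prod_k ((-1) ^+ e k * G k) = (-1) ^+ (\sum_k e k)%N * \prod_k G k.
Proof.
elim: r e G => [|r IH] e G; first by rewrite !big_ord0 mulr1.
rewrite 3!big_ord_recl (IH (fun k => e (lift ord0 k)) (fun k => G (lift ord0 k))).
rewrite exprD.
rewrite -mulrA.
rewrite -[RHS]mulrA.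
congr (_ * _).
by rewrite mulrA (commr_sign (G ord0)) -mulrA.
Qed.

Lemma prod_interleave r (a b : 'I_r -> Lam) (al be : 'I_r -> bool) :
  (forall k, ghom (al k) (a k)) -> (forall k, ghom (be k) (b k)) ->
  (\prod_k a k) * (\prod_k b k) =
  (-1) ^+ (\sum_(k < r) \sum_(j < r | (k < j)%N) be k * al j)%N * \prod_k (a k * b k).
Proof.
elim: r a b al be => [|r IH] a b al be ha hb.
  by rewrite !big_ord0 !mulr1.
rewrite !big_ord_recl /= -mulrA (mulrA _ (b ord0)).
have hp := ghom_prod (fun k => ha (lift ord0 k)).
rewrite (gmulC (hb ord0) hp) -!mulrA.
rewrite (IH _ _ _ _ (fun k => ha (lift ord0 k)) (fun k => hb (lift ord0 k))).
rewrite mulrA (commr_sign (a _)) -mulrA; rewrite (mulrA (b _)) (commr_sign (b _)) -mulrA.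
rewrite (mulrA (a _)) (commr_sign (a _)) -!mulrA mulrA -exprD !mulrA; congr (_ * _ * _ * _).
apply: signr_eq_odd; rewrite !oddD; congr (_ (+) _).
  rewrite oddM [in RHS]big_mkcond big_ord_recl /= add0n -big_distrr /=.
  by rewrite oddM !oddb.
apply: odd_sum => k _; congr odd.
by rewrite [RHS]big_mkcond big_ord_recl /= add0n [LHS]big_mkcond.
Qed.

Lemma gtwist_add (i j : nat) (x : Lam) :
  gtwist (i + j) x = gtwist i (gtwist j x).
Proof. by apply/malgP => A; rewrite !gtwistE mulnDl exprD mulrA. Qed.

Lemma eq_prod_adjacent r (F G : 'I_r -> Lam) (k l : 'I_r) :
  l = k.+1 :> nat -> F k * F l = G k * G l ->
  (forall j, j != k -> j != l -> F j = G j) -> \prod_j F j = \prod_j G j.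
Proof.
elim: r F G k l => [|r IH] F G k l e; first by case: k e.
case: (unliftP ord0 k) e => [k' ->|->] e h hj; last first.
  case: r {IH} F G k l e h hj => [|r] F G k l e h hj; first by case: l e h hj => -[].
  have el : l = lift ord0 ord0 by exact: val_inj.
  rewrite el in h hj; rewrite 4!big_ord_recl !mulrA h; congr (_ * _).
  by apply: eq_bigr => j _; apply: hj.
case: (unliftP ord0 l) e h hj => [l' ->|->] // e h hj.
rewrite 2!big_ord_recl (hj ord0) //; congr (_ * _).
apply: (IH _ _ k' l') => //; first by case: e.
by move=> j jk jl; apply: hj; rewrite (inj_eq lift_inj).
Qed.

End GrassmannProducts.

(* M is a free Lambda-supermodule with a finite homogeneous basis (E_x), E_x of
   parity p x.  Both modules M and M^* = Hom_Lambda(M, Lambda) are given by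
   their coordinates:
   - w : {ffun X -> Lambda} stands for \sum_x E_x w_x in M,
   - f : {ffun X -> Lambda} stands for the right-linear map with
     f(E_x) = f_x, i.e., for \sum_x f_x T_x with (T_x) the dual basis. *)
Section FreeSupermodule.
Variables (C : comNzRingType) (X : finType) (p : X -> bool).
Local Notation Lam := (grassmann C).
Local Notation coords := {ffun X -> Lam}.
Implicit Types (f w : coords) (c d : bool).

Definition dual_apply f w : Lam := \sum_x f x * w x.

Definition homogeneous d w : bool := [forall x, ghom (d (+) p x) (w x)].

(* The r-th tensor powers over Lambda of M and M^* are the free modules on the
   words E_(x_1) ⊗ ... ⊗ E_(x_r), resp. T_(x_1) ⊗ ... ⊗ T_(x_r), of length r;
   elements of T^r(M) are again written with their coordinates on the right,
   those of T^r(M^* ) with their coordinates on the left. *)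
Definition tpower r := {ffun {ffun 'I_r -> X} -> Lam}.

(* f_1 ⊗ ... ⊗ f_r: the coordinate of f_k moves left across T_(x_j), j < k. *)
Definition dual_tensor r (f : 'I_r -> coords) : tpower r :=
  [ffun x : {ffun 'I_r -> X} =>
    \prod_(k < r) gtwist (\sum_(j < r | (j < k)%N) p (x j)) (f k (x k))].

(* w_1 ⊗ ... ⊗ w_r: the coordinate of w_k moves right across E_(x_j), k < j. *)
Definition tensor r (w : 'I_r -> coords) : tpower r :=
  [ffun x : {ffun 'I_r -> X} =>
    \prod_(k < r) gtwist (\sum_(j < r | (k < j)%N) p (x j)) (w k (x k))].

Definition dual_scaler f (lam : Lam) : coords :=
  [ffun x => f x * gtwist (p x) lam].
Definition dual_scalel (lam : Lam) f : coords := [ffun x => lam * f x].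
Definition scaler w (lam : Lam) : coords := [ffun x => w x * lam].
Definition scalel (lam : Lam) w : coords := [ffun x => gtwist (p x) lam * w x].

Lemma dual_tensor_balanced r (f : 'I_r -> coords) (k l : 'I_r) lam :
  l = k.+1 :> nat ->
  dual_tensor (fun j => if j == k then dual_scaler (f j) lam else f j) =
  dual_tensor (fun j => if j == l then dual_scalel lam (f j) else f j).
Proof.
move=> e; have nkl : k != l by rewrite -val_eqE /= e neq_ltn ltnSn.
apply/ffunP => x; rewrite !ffunE; apply: (eq_prod_adjacent e); last first.
  by move=> j /negPf -> /negPf ->.
rewrite !eqxx (negPf nkl) eq_sym (negPf nkl) !ffunE !gtwistM -mulrA.
rewrite -gtwist_add; congr (_ * (gtwist _ _ * _)).
by rewrite [RHS](bigD1 k) ?e // addnC; congr (_ + _)%N; apply: eq_bigl => j;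
  rewrite ltnS ltn_neqAle andbC.
Qed.

Lemma tensor_balanced r (w : 'I_r -> coords) (k l : 'I_r) lam :
  l = k.+1 :> nat ->
  tensor (fun j => if j == k then scaler (w j) lam else w j) =
  tensor (fun j => if j == l then scalel lam (w j) else w j).
Proof.
move=> e; have nkl : k != l by rewrite -val_eqE /= e neq_ltn ltnSn.
apply/ffunP => x; rewrite !ffunE; apply: (eq_prod_adjacent e); last first.
  by move=> j /negPf -> /negPf ->.
rewrite !eqxx (negPf nkl) eq_sym (negPf nkl) !ffunE !gtwistM -mulrA.
rewrite -gtwist_add; congr (_ * (gtwist _ _ * _)).
by rewrite [LHS](bigD1 l) ?e // addnC; congr (_ + _)%N; apply: eq_bigl => j;
  rewrite -val_eqE /= e [RHS]ltn_neqAle eq_sym andbC.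
Qed.

(* The Lambda-bilinear extension of
   ev (T_(x_1) ⊗ ... ⊗ T_(x_r) ⊗ E_(x_1) ⊗ ... ⊗ E_(x_r))
     = (-1) ^ (\sum_j |E_(x_j)| (|T_(x_(j+1))| + ... + |T_(x_r)|)),
   ev being 0 on the other pairs of words; see evE for the formula on
   homogeneous pure tensors. *)
Definition ev r (F G : tpower r) : Lam :=
  \sum_(x : {ffun 'I_r -> X})
    (-1) ^+ (\sum_(j < r) p (x j) * \sum_(l < r | (j < l)%N) p (x l))%N
         * (F x * G x).

Lemma evE r (f w : 'I_r -> coords) (c d : 'I_r -> bool) :
  (forall j, homogeneous (c j) (f j)) -> (forall j, homogeneous (d j) (w j)) ->
  ev (dual_tensor f) (tensor w) =
  (-1) ^+ (\sum_(j < r) d j * \sum_(l < r | (j < l)%N) c l)%N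
    * \prod_j dual_apply (f j) (w j).
Proof.
move=> hf hw; rewrite /dual_apply bigA_distr_bigA mulr_sumr.
apply: eq_bigr => x _; rewrite !ffunE.
have Hf k : ghom (c k (+) p (x k)) (f k (x k)) by move/forallP: (hf k).
have Hw k : ghom (d k (+) p (x k)) (w k (x k)) by move/forallP: (hw k).
rewrite (prod_interleave (fun k => ghom_twist _ (Hf k)) (fun k => ghom_twist _ (Hw k))).
set s1 := (\sum_j _)%N; set s2 := (\sum_k _)%N; set s3 := (\sum_j _)%N.
pose e (k : 'I_r) := ((\sum_(j < r | (j < k)%N) p (x j)) * (c k (+) p (x k))
   + (\sum_(j < r | (k < j)%N) p (x j)) * (d k (+) p (x k)))%N.
rewrite (eq_bigr (fun k => (-1) ^+ e k * (f k (x k) * w k (x k)))); last first.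
  move=> k _; rewrite (gtwist_hom _ (Hf k)) (gtwist_hom _ (Hw k)) /e exprD.
  by rewrite -!mulrA; congr (_ * _); rewrite mulrA (commr_sign (f _ _)) -mulrA.
rewrite prod_signr !mulrA -!exprD; congr (_ * _); apply: signr_eq_odd.
rewrite {}/s1 {}/s2 {}/s3 {}/e big_split /=.
rewrite (eq_bigr (fun k : 'I_r => \sum_(l < r | (k < l)%N) p (x k) * p (x l))%N);
  last by move=> k _; rewrite big_distrr.
rewrite [in RHS](eq_bigr (fun k : 'I_r => \sum_(l < r | (k < l)%N) d k * c l)%N);
  last by move=> k _; rewrite big_distrr.
set A1 := (\sum_(i < r) \sum_(l < r | _) p _ * _)%N.
set A2 := (\sum_(i < r) \sum_(l < r | _) _ * _)%N.
have -> : (\sum_(i < r) (\sum_(j < r | j < i) p (x j)) * (c i (+) p (x i)) =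
    \sum_(i < r) \sum_(l < r | i < l) p (x i) * (c l (+) p (x l)))%N.
  under eq_bigr do rewrite big_distrl /= big_mkcond.
  by rewrite exchange_big /=; apply: eq_bigr => k _; rewrite [RHS]big_mkcond.
have -> : (\sum_(i < r) (\sum_(j < r | i < j) p (x j)) * (d i (+) p (x i)) =
    \sum_(i < r) \sum_(l < r | i < l) p (x l) * (d i (+) p (x i)))%N.
  by apply: eq_bigr => k _; rewrite big_distrl.
rewrite {}/A1 {}/A2 -!big_split /=.
apply: odd_sum => k _; rewrite -!big_split /=; apply: odd_sum => l _.
by move: (c l) (d k) (p (x l)) (p (x k)); do 4!case.
Qed.

(* The degree r component of the ideal I(M^* ) of T(M^* ): it is spanned by the
   f_1 ⊗ ... ⊗ (u ⊗ v - (-1)^(|u||v|) v ⊗ u) ⊗ ... ⊗ f_r, with u = f_k and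
   v = f_(k+1) homogeneous. *)
Inductive symideal r : tpower r -> Prop :=
| symideal0 : symideal 0
| symidealB t1 t2 : symideal t1 -> symideal t2 -> symideal (t1 - t2)
| symideal_swap (f : 'I_r -> coords) (k l : 'I_r) c d :
    l = k.+1 :> nat -> homogeneous c (f k) -> homogeneous d (f l) ->
    symideal (dual_tensor f
              - dual_tensor (fun j => f (tperm k l j)) *~ (-1) ^+ (c * d)).

Definition symideal_pred r : {pred tpower r} := fun t => `[< symideal t >].

Fact symideal_zmod_closed r : zmod_closed (@symideal_pred r).
Proof.
split=> [|t1 t2 /asboolP h1 /asboolP h2]; apply/asboolP; first exact: symideal0.
exact: symidealB.
Qed.

HB.instance Definition _ r :=
  GRing.isZmodClosed.Build (tpower r) (@symideal_pred r) (symideal_zmod_closed r).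

Definition spower r := Quotient.quot (@symideal_pred r).
HB.instance Definition _ r := GRing.Zmodule.on (spower r).
HB.instance Definition _ r :=
  EqQuotient.on (spower r).

Definition varpi r (t : tpower r) : spower r := \pi_(spower r)%qT t.

Lemma varpi_eq r (t1 t2 : tpower r) :
  varpi t1 = varpi t2 <-> symideal (t1 - t2).
Proof.
split=> [|h]; rewrite /varpi.
  by move/eqP; rewrite -Quotient.idealrBE => /asboolP.
by apply/eqP; rewrite -Quotient.idealrBE; apply/asboolP.
Qed.

(* repr F is a lift of F to T^r(M^* ); for w even the value does not depend on
   the lift. *)
Definition restitution r (F : spower r) w : Lam :=
  ev (generic_quotient.repr F) (tensor (fun _ => w)).

End FreeSupermodule.

Section Supermatrices.
Variables (C : comNzRingType) (m n : nat).
Local Notation Lam := (grassmann C).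
Implicit Types (A : 'M[Lam]_(m + n)) (c d : bool).

Definition vparity (i : 'I_(m + n)) : bool := (m <= i)%N.

(* U = V ⊗ Lambda is 'cV_(m + n), v standing for \sum_i e_i v_i; U^* is
   'rV_(m + n), phi standing for the right-linear map w |-> phi *m w, and
   U_1^1 = End_Lambda(U) is 'M_(m + n), A standing for w |-> A *m w. Hence
   v ⊗ phi is v *m phi, e_l ⊗ e_u^* is delta_mx l u, and the product of U_1^1
   is the matrix product. *)
Definition U_homogeneous d (v : 'cV[Lam]_(m + n)) : bool :=
  [forall i, ghom (d (+) vparity i) (v i 0)].

Definition Udual_homogeneous d (phi : 'rV[Lam]_(m + n)) : bool :=
  [forall i, ghom (d (+) vparity i) (phi 0 i)].

Definition End_homogeneous d A : bool :=
  [forall l, forall u, ghom (d (+) vparity l (+) vparity u) (A l u)].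

(* The additive extension of str (v ⊗ phi) = (-1) ^ (|v||phi|) phi v, see
   supertraceE. *)
Definition supertrace A : Lam :=
  \sum_l (-1) ^+ vparity l * gtwist (vparity l) (A l l).

Lemma supertraceE c d (v : 'cV[Lam]_(m + n)) (phi : 'rV[Lam]_(m + n)) :
  U_homogeneous c v -> Udual_homogeneous d phi ->
  supertrace (v *m phi) = (-1) ^+ (c * d) * (phi *m v) 0 0.
Proof.
move=> /forallP hv /forallP hphi; rewrite /supertrace !mxE mulr_sumr.
apply: eq_bigr => l _; rewrite !mxE big_ord1.
have h := ghomM (hv l) (hphi l).
rewrite (gtwist_hom _ h) (gmulC (hphi l) (hv l)) 2!mulrA -2!exprD; congr (_ * _).
by apply: signr_eq_odd; move: (vparity l) => {h}; case: c {hv}; case: d {hphi}; case.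
Qed.

End Supermatrices.

Section Invariants.
Variables (C : comNzRingType) (m n s : nat).
Local Notation Lam := (grassmann C).

(* W = \bigoplus_(i < s) U_1^1 *)
Definition supermatrix_sum := {ffun 'I_s -> 'M[Lam]_(m + n)}.

Definition Windex : finType := ('I_s * 'I_(m + n) * 'I_(m + n))%type.

Definition Wparity (x : Windex) : bool := vparity x.1.2 (+) vparity x.2.

Definition Wbasis (x : Windex) : supermatrix_sum :=
  [ffun j => if j == x.1.1 then delta_mx x.1.2 x.2 else 0].

(* As (e_l ⊗ e_u^* c) (e_u) = e_l (-1)^(|c||e_u|) c, the matrix entry A l u is
   the twist of the right coordinate c of A along e_l ⊗ e_u^*. *)
Definition Wcoords (w : supermatrix_sum) : {ffun Windex -> Lam} :=
  [ffun x => gtwist (vparity x.2) (w x.1.1 x.1.2 x.2)].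

Definition W_homogeneous d (w : supermatrix_sum) : bool :=
  [forall i, End_homogeneous d (w i)].

Lemma W_homogeneousE d w :
  W_homogeneous d w = homogeneous Wparity d (Wcoords w).
Proof.
have tw c k (x : Lam) : ghom c (gtwist k x) = ghom c x.
  apply/idP/idP => [h|]; last exact: ghom_twist.
  suff -> : x = gtwist k (gtwist k x) by exact: ghom_twist.
  by apply/malgP => A; rewrite !gtwistE mulrA -exprD addnn -signr_odd odd_double mul1r.
apply/forallP/forallP => [h [[i l] u]|h i].
  by rewrite ffunE tw /Wparity addbA; move/forallP: (h i) => /(_ l)/forallP.
apply/forallP => l; apply/forallP => u.
by have := h (i, l, u); rewrite ffunE tw /Wparity addbA.
Qed.

(* T(i)_l^u *)
Definition Tdual (i : 'I_s) (l u : 'I_(m + n)) : {ffun Windex -> Lam} :=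
  [ffun x => (x == (i, l, u))%:R].

Lemma TdualE i l u (x : Windex) :
  dual_apply (Tdual i l u) (Wcoords (Wbasis x)) = (x == (i, l, u))%:R.
Proof.
rewrite /dual_apply (bigD1 (i, l, u)) //= big1 => [|y ny]; last first.
  by rewrite ffunE (negPf ny) mul0r.
rewrite !ffunE eqxx mul1r addr0 /=; case: x => [[j l'] u'] /=.
rewrite !xpair_eqE [i == j]eq_sym; case: eqP => _ /=; last first.
  by rewrite mxE gtwist0.
rewrite mxE [l == l']eq_sym [u == u']eq_sym.
case: (_ && _); last exact: gtwist0.
by rewrite (gtwist_hom _ (ghom1 C)) muln0 mul1r.
Qed.

Variable md : 'I_s -> nat.
Local Notation N := (\sum_(i < s) md i)%N.

Definition block (k : 'I_N) : 'I_s := tagnat.sig1 k.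

Lemma blockP (k : 'I_N) :
  (\sum_(i < s | (i < block k)%N) md i <= k <
   \sum_(i < s | (i <= block k)%N) md i)%N.
Proof.
rewrite (tagnat.rect k) leq_addr /=.
rewrite [X in (_ < X)%N](bigD1 (tagnat.sig1 k)) //= addnC.
rewrite [X in (_ < _ + X)%N](eq_bigl (fun i : 'I_s => (i < tagnat.sig1 k)%N)).
  by rewrite ltn_add2r ltn_ord.
by move=> i; rewrite ltn_neqAle andbC.
Qed.

(* F lies in S^(md_1, ..., md_s)(W^* ). *)
Definition multidegree (F : spower C Wparity N) : Prop :=
  exists2 t, varpi Wparity t = F &
    forall x : {ffun 'I_N -> Windex}, t x != 0 ->
      forall i, #|[set k | (x k).1.1 == i]| = md i.

Section Picture.
Variables (sigma : 'S_N) (r : {ffun 'I_N -> 'I_(m + n)}).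
Let a (k : 'I_N) : nat := vparity (r k).

Definition picture_gamma : int :=
  \prod_(k < N) \prod_(l < N | (k < l)%N && (sigma l < sigma k)%N)
    (-1) ^+ (a (sigma k) * a (sigma l)).

Definition picture_q : nat :=
  (\sum_(k < N) a (sigma k) * (\sum_(l < N | (l < k)%N) a l)
   + \sum_(k < N) a k
   + \sum_(k < N) \sum_(l < N | (k < l)%N) a k * a l
   + \sum_(k < N) \sum_(l < N | (k < l)%N)
       (a (sigma k) + a k) * (a (sigma l) + a l))%N.

End Picture.

Definition picture_invariant (sigma : 'S_N) : spower C Wparity N :=
  \sum_(r : {ffun 'I_N -> 'I_(m + n)})
    varpi Wparity
      (dual_tensor Wparity (fun k => Tdual (block k) (r (sigma k)) (r k)))
    *~ (picture_gamma sigma r * (-1) ^+ picture_q sigma r).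

End Invariants.

(* cs is a way of writing s as a product of disjoint cycles, the 1-cycles
   included; a cycle [:: i_1; ...; i_p] sends i_1 to i_2, ..., i_p to i_1. *)
Definition cycle_decomposition (T : finType) (s : {perm T})
    (cs : seq (seq T)) : Prop :=
  [/\ uniq (flatten cs), forall x, x \in flatten cs,
      [::] \notin cs & all (fcycle s) cs].

Lemma cycle_decomposition_exists (T : finType) (s : {perm T}) :
  exists cs, cycle_decomposition s cs.
Proof.
have inj : injective s by exact: perm_inj.
have sym := fconnect_sym inj.
exists [seq fingraph.orbit s x | x <- enum (froots s)]; split.
- have hr : {in enum (froots s), forall x, froots s x}.
    by move=> x; rewrite mem_enum.
  elim: (enum (froots s)) (enum_uniq (froots s)) hr => //= x rs IH.
  move=> /andP[xrs urs] hr.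
  rewrite cat_uniq orbit_uniq IH //= ?andbT; last first.
    by move=> y yrs; apply: hr; rewrite inE yrs orbT.
  apply/hasPn => y /flatten_mapP[z zrs yz]; apply/negP => /= yx.
  have /(fingraph.rootP sym) e : fconnect s x z.
    by apply: (@connect_trans _ _ y); rewrite 1?[_ y z]sym fconnect_orbit.
  have rx : froots s x by apply: hr; rewrite mem_head.
  have rz : froots s z by apply: hr; rewrite inE zrs orbT.
  by move: xrs; rewrite -(eqP rx) e (eqP rz) zrs.
- move=> x; apply/flatten_mapP; exists (froot s x).
    by rewrite mem_enum; exact: roots_root.
  by rewrite -fconnect_orbit sym connect_root.
- apply/negP => /mapP[x _ e].
  by have := fingraph.in_orbit s x; rewrite -e.
- by apply/allP => _ /mapP[x _ ->]; exact: cycle_orbit.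
Qed.

(* tr_sigma(A_1 ⊗ ... ⊗ A_N), for cs a cycle decomposition of sigma^-1 *)
Definition trace_monomial (C : comNzRingType) (m n : nat) (T : Type)
    (cs : seq (seq T)) (A : T -> 'M[grassmann C]_(m + n)) : grassmann C :=
  \prod_(c <- cs) supertrace (\prod_(k <- c) A k).

Arguments picture_invariant C m n {s md} sigma.
Arguments multidegree {C m n s} md F.

(* Main.v *)
(* On an even w, moving each coordinate of w back to its own factor cancels all
   the signs of ev, so ev (f_1 ⊗ ... ⊗ f_N) (w ⊗ ... ⊗ w) is the plain ordered
   product f_1(w) ... f_N(w).  Restitution therefore turns the summand of
   phi_sigma indexed by r into a sign times the product, in the order 1, ..., N,
   of the entries B_k = A_k (r_sigma(k)) (r_k), while the trace monomial is the
   sum over r of the same entries multiplied in the order in which a cycle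
   decomposition of sigma^-1 lists the indices, with one factor -1 for every
   cycle whose last index is odd.  B_k has parity a_sigma(k) + a_k, and
   reordering costs the Koszul sign, so the theorem reduces to an identity mod 2
   between quadratic forms in the parities a_1, ..., a_N. *)
Require Import Defs.
From HB Require Import structures.
From mathcomp Require Import all_boot all_order all_algebra all_fingroup.
From mathcomp Require Import finmap monalg.
From mathcomp Require Import reals complex.

Set Implicit Arguments.
Unset Strict Implicit.
Unset Printing Implicit Defensive.

Import GRing.Theory Num.Theory.
Local Open Scope ring_scope.

(** * Even arguments: evaluation of pure tensors and descent to the supersymmetric algebra *)

Section Restitution.
Variable C : comNzRingType.
Local Notation Lam := (grassmann C).

Lemma gtwist_sum I n (s : seq I) (F : I -> Lam) :
  gtwist n (\sum_(i <- s) F i) = \sum_(i <- s) gtwist n (F i).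
Proof. exact: (big_morph (gtwist n) (@gtwistD C n) (gtwist0 C n)). Qed.

Lemma eq_gtwist i j (x : Lam) : odd i = odd j -> gtwist i x = gtwist j x.
Proof.
move=> e; apply/malgP => A; rewrite !gtwistE; congr (_ * _).
by apply: signr_eq_odd; rewrite !oddM e.
Qed.

Lemma gtwist_even n (x : Lam) : ~~ odd n -> gtwist n x = x.
Proof.
move=> /negPf e; rewrite (@eq_gtwist n 0) ?e //; apply/malgP => A.
by rewrite gtwistE mul0n mul1r.
Qed.

Lemma gtwist_prod n r (F : 'I_r -> Lam) :
  gtwist n (\prod_k F k) = \prod_k gtwist n (F k).
Proof.
apply: (big_morph (gtwist n) (@gtwistM C n)).
by rewrite (gtwist_hom n (ghom1 C)) muln0 mul1r.
Qed.

(** Expanding [x] into monomials, each of them homogeneous, reduces the claim to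
    supercommutativity. *)
Lemma gmul_gtwist (c : bool) (x y : Lam) : ghom c y -> y * x = gtwist c x * y.
Proof.
move=> hy; rewrite (monalgE x) gtwist_sum mulr_sumr mulr_suml.
apply: eq_bigr => A _; have hA := ghomU x@_A A.
by rewrite (gmulC hA hy) (gtwist_hom c hA) mulrA mulnC.
Qed.

(** Each [b j] moves left past the [a k] with [j < k] and twists them. The [a k] may have mixed
    parity, so the twists cannot be replaced by a global sign. *)
Lemma prod_gtwist_interleave r (a b : 'I_r -> Lam) (be : 'I_r -> bool) :
  (forall k, ghom (be k) (b k)) ->
  (\prod_k a k) * (\prod_k b k) =
  \prod_(k < r) (gtwist (\sum_(j < r | (j < k)%N) be j)%N (a k) * b k).
Proof.
elim: r a b be => [|r IH] a b be hb; first by rewrite !big_ord0 mulr1.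
have hb' k := hb (lift ord0 k).
rewrite [RHS]big_ord_recl [gtwist _ (a ord0)]gtwist_even; last first.
  by rewrite [X in odd X]big_pred0.
rewrite [\prod_k a k]big_ord_recl [\prod_k b k]big_ord_recl.
set P := \prod_(i < r) a _; rewrite -mulrA [P * _]mulrA.
have -> : P * b ord0 = b ord0 * gtwist (be ord0) P.
  rewrite (gmul_gtwist _ (hb ord0)) -gtwist_add gtwist_even //.
  by rewrite oddD addbb.
rewrite -!mulrA gtwist_prod (IH _ _ _ hb'); congr (_ * (_ * _)).
apply: eq_bigr => k _; rewrite -gtwist_add; congr (gtwist _ _ * _).
by rewrite [RHS]big_mkcond big_ord_recl addnC -big_mkcond.
Qed.

Variables (X : finType) (p : X -> bool).
Local Notation coords := {ffun X -> Lam}.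

Lemma ghom_dual_apply c d (f w : coords) :
  homogeneous p c f -> homogeneous p d w -> ghom (c (+) d) (dual_apply f w).
Proof.
move=> /forallP hf /forallP hw; apply: ghom_sum => x _.
have -> : c (+) d = (c (+) p x) (+) (d (+) p x).
  by rewrite addbACA addbb addbF.
exact: ghomM.
Qed.

Lemma ev_tensor_even r (f : 'I_r -> coords) (w : coords) :
  homogeneous p false w ->
  ev p (dual_tensor p f) (tensor p (fun=> w)) = \prod_k dual_apply (f k) w.
Proof.
move=> /forallP hw; rewrite /dual_apply bigA_distr_bigA.
apply: eq_bigr => x _; rewrite !ffunE.
rewrite [X in _ * (_ * X)](_ : _ =
    \prod_(k < r) ((-1) ^+ (p (x k) * \sum_(j < r | (k < j)%N) p (x j)) * w (x k)));
  last by apply: eq_bigr => k _; rewrite (gtwist_hom _ (hw _)) mulnC.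
(* The sign in [ev] and the one left by the twists in [tensor] have the same exponent and cancel. *)
rewrite prod_signr [X in _ * X]mulrA commr_sign 2!mulrA -exprD.
rewrite addnn -signr_odd odd_double mul1r.
(* Interleaving gives the coordinate of [f k] the same twist as [dual_tensor] does, and twisting
   twice is the identity. *)
rewrite (prod_gtwist_interleave _ (fun k => hw (x k))).
apply: eq_bigr => k _; rewrite -gtwist_add gtwist_even //.
by rewrite oddD addbb.
Qed.

(** The arguments of [ev] are exchanged so that additivity in the dual tensor can be declared as a
    morphism instance. *)
Definition evr r (G F : tpower C X r) : Lam := ev p F G.

Lemma evr_is_zmod_morphism r (G : tpower C X r) : zmod_morphism (evr G).
Proof.
move=> F1 F2; rewrite /evr /ev -sumrB; apply: eq_bigr => x _.
by rewrite !ffunE mulrBl mulrBr.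
Qed.

HB.instance Definition _ r (G : tpower C X r) :=
  GRing.isZmodMorphism.Build (tpower C X r) Lam (evr G)
    (evr_is_zmod_morphism G).

(** At an even [w], a homogeneous [f k] takes a value of its own parity, so exchanging two
    neighbouring values costs exactly the sign in a generator of the ideal. *)
Lemma ev_symideal r (t : tpower C X r) (w : coords) :
  homogeneous p false w -> symideal p t -> ev p t (tensor p (fun=> w)) = 0.
Proof.
move=> hw; rewrite -/(evr _ t); elim=> [|t1 t2 _ h1 _ h2|f k l c d e hk hl].
- by rewrite raddf0.
- by rewrite raddfB /= h1 h2 subrr.
have nkl : k != l by rewrite -val_eqE /= e neq_ltn ltnSn.
rewrite raddfB raddfMz /= /evr !ev_tensor_even // -mulrzl rmorphXn rmorphN1.
set G := \prod_k0 _; apply/eqP; rewrite subr_eq0; apply/eqP.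
(* Attaching the sign to the factor [k] makes the two products differ in two adjacent factors
   only. *)
transitivity (\prod_j ((-1) ^+ (if j == k then c * d else 0)%N
                       * dual_apply (f (tperm k l j)) w)); last first.
  by rewrite prod_signr -big_mkcond big_pred1_eq.
apply: (eq_prod_adjacent e) => [|j jk jl]; last first.
  by rewrite (negPf jk) mul1r tpermD // eq_sym.
rewrite eqxx [l == k]eq_sym (negPf nkl) tpermL tpermR mul1r -mulrA.
by rewrite mulnC (gmulC (ghom_dual_apply hl hw) (ghom_dual_apply hk hw)) !addbF.
Qed.

(** The representative chosen for [varpi p t] differs from [t] by an element of the ideal, on which
    evaluation at even arguments vanishes. *)
Lemma restitution_varpi r (t : tpower C X r) (w : coords) :
  homogeneous p false w ->
  restitution (varpi p t) w = ev p t (tensor p (fun=> w)).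
Proof.
move=> hw; apply/eqP; rewrite -subr_eq0 /restitution -!/(evr _ _) -raddfB.
apply/eqP/ev_symideal => //; apply/varpi_eq; exact: reprK.
Qed.

Lemma varpi_is_zmod_morphism r : zmod_morphism (@varpi C X p r).
Proof. exact: raddfB. Qed.

HB.instance Definition _ r :=
  GRing.isZmodMorphism.Build (tpower C X r) (spower C p r) (@varpi C X p r)
    (@varpi_is_zmod_morphism r).

End Restitution.

(** * The identity mod 2 between the two sign exponents *)

Section Parity.
Variables (N : nat) (sigma : 'S_N) (a : 'I_N -> bool).

(** Off the diagonal, the terms at [(k, l)] and [(l, k)] cancel mod 2. *)
Lemma even_pair_sum (G : 'I_N -> 'I_N -> nat) :
  (forall k, ~~ odd (G k k)) ->
  (forall k l : 'I_N, (k < l)%N -> odd (G k l) = odd (G l k)) ->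
  ~~ odd (\sum_k \sum_l G k l).
Proof.
move=> h0 hs.
have split k : (\sum_l G k l = G k k + (\sum_(l < N | (k < l)%N) G k l
                              + \sum_(l < N | (l < k)%N) G k l))%N.
  rewrite (bigD1 k) //=; congr (_ + _)%N; rewrite (bigID (fun l : 'I_N => (k < l)%N)) /=.
  by congr (_ + _)%N; apply: eq_bigl => l; rewrite -val_eqE /=; case: ltngtP.
rewrite (eq_bigr _ (fun k _ => split k)) !big_split /=.
rewrite [X in (_ + (_ + X))%N](exchange_big_dep xpredT) //= 2!oddD.
rewrite (_ : odd (\sum_k G k k) = false); last first.
  by rewrite (odd_sum _ (G := fun=> 0%N)) ?big1 // => k _; apply/negbTE.
rewrite addFb -[X in _ (+) X](odd_sum _ (F := fun k : 'I_N => (\sum_(l < N | (k < l)%N) G k l)%N)).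
  by rewrite addbb.
move=> k _; apply: odd_sum => l kl; exact: hs.
Qed.

Local Notation n := (sigma^-1)%g.

Lemma sum_perm (F : 'I_N -> 'I_N -> nat) :
  (\sum_k F k (sigma k) = \sum_k F (n k) k)%N.
Proof.
by rewrite (reindex_inj (@perm_inj _ n)); apply: eq_bigr => k _; rewrite permKV.
Qed.

Lemma sum_cond (P : rel 'I_N) (F : 'I_N -> 'I_N -> nat) :
  (\sum_k \sum_(l | P k l) F k l = \sum_k \sum_l P k l * F k l)%N.
Proof.
apply: eq_bigr => k _; rewrite big_mkcond; apply: eq_bigr => l _.
by case: (P k l); rewrite ?mul1n ?mul0n.
Qed.

Lemma sum2_perm (P : 'I_N -> 'I_N -> nat) :
  (\sum_k \sum_l P k l * (a (sigma k) * a (sigma l))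
   = \sum_k \sum_l P (n k) (n l) * (a k * a l))%N.
Proof.
rewrite (sum_perm (fun k k' => \sum_l P k l * (a k' * a (sigma l)))%N).
apply: eq_bigr => k _.
by rewrite (sum_perm (fun l l' => P (n k) l * (a k * a l'))%N).
Qed.

Lemma sum2_perml (P : 'I_N -> 'I_N -> nat) :
  (\sum_k \sum_l P k l * (a (sigma k) * a l)
   = \sum_k \sum_l P (n k) l * (a k * a l))%N.
Proof. exact: (sum_perm (fun k k' => \sum_l P k l * (a k' * a l))%N). Qed.

Lemma sum2_permr (P : 'I_N -> 'I_N -> nat) :
  (\sum_k \sum_l P k l * (a k * a (sigma l))
   = \sum_k \sum_l P k (n l) * (a k * a l))%N.
Proof.
apply: eq_bigr => k _.
by rewrite (sum_perm (fun l l' => P k l * (a k * a l'))%N).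
Qed.

(** Mod 2, [a (sigma k) + a k] is the parity of the [k]-th matrix entry. The product expands into
    four sums, each reindexed separately. *)
Lemma sum_pair_degrees (P : 'I_N -> 'I_N -> nat) :
  (\sum_k \sum_l P k l * ((a (sigma k) + a k) * (a (sigma l) + a l))
   = \sum_k \sum_l (P (n k) (n l) + P k l + P (n k) l + P k (n l)) * (a k * a l))%N.
Proof.
under [RHS]eq_bigr do (under eq_bigr do rewrite 3!mulnDl; rewrite 3!big_split /=).
rewrite 3!big_split /= -sum2_perm -sum2_perml -sum2_permr -!big_split /=.
apply: eq_bigr => k _; rewrite -!big_split /=; apply: eq_bigr => l _.
by rewrite -!mulnDr; congr (_ * _)%N; do 4!case: (a _).
Qed.

Lemma sum_diag (Q : 'I_N -> 'I_N) (P : 'I_N -> nat) :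
  (\sum_k P k * (a k * a (Q k)) =
   \sum_k \sum_l (P k * (l == Q k)) * (a k * a l))%N.
Proof.
apply: eq_bigr => k _; rewrite (bigD1 (Q k)) //= big1 => [|l /negPf ->].
  by rewrite eqxx addn0 muln1.
by rewrite muln0 mul0n.
Qed.

Variable pos : 'I_N -> nat.
Hypothesis pos_inj : injective pos.
(* Satisfied when pos lists the cycles of n = sigma^-1 one after the other. *)
Hypothesis pos_cycle : forall k l, (pos k < pos l)%N ->
  (pos (n k) < pos (n l))%N = (pos (n k) <= pos l)%N (+) (pos (n l) <= pos k)%N.

(* Both exponents become sums of c(k, l) a_k a_l over ordered pairs (k, l), the
   indices sigma k being eliminated by the substitution k -> n k; only c(k, k)
   and c(k, l) + c(l, k) matter mod 2, and these are determined by the relative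
   order of k, l, n k, n l and of their positions. *)
Local Notation psum P := (\sum_(k < N) \sum_(l < N) P k l * (a k * a l))%N.

Lemma picture_exponent_parity :
  odd ((\sum_(k < N) \sum_(l < N | (k < l)%N && (sigma l < sigma k)%N)
          a (sigma k) * a (sigma l))
     + (\sum_(k < N) a (sigma k) * (\sum_(l < N | (l < k)%N) a l)
        + \sum_(k < N) a k
        + \sum_(k < N) \sum_(l < N | (k < l)%N) a k * a l
        + \sum_(k < N) \sum_(l < N | (k < l)%N)
            (a (sigma k) + a k) * (a (sigma l) + a l))
     + \sum_(k < N) a k * (a (sigma k) + a k))%N
  = odd ((\sum_(k < N) \sum_(l < N | (k < l)%N && (pos l < pos k)%N)
            (a (sigma k) + a k) * (a (sigma l) + a l))
         + \sum_(k < N | (pos (n k) <= pos k)%N) a k)%N.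
Proof.
(* The coefficients [g] come from [picture_gamma], [q1], [q2] and [q3] from the first three sums of
   [picture_q], and [tw] from the twists in [Wcoords]. *)
pose g (k l : 'I_N) : nat := ((n k < n l)%N && (l < k)%N).
have -> : (\sum_(k < N) \sum_(l < N | (k < l)%N && (sigma l < sigma k)%N)
          a (sigma k) * a (sigma l) = psum g)%N.
  rewrite (sum_cond (fun k l : 'I_N => (k < l)%N && (sigma l < sigma k)%N)).
  rewrite (sum2_perm (fun k l : 'I_N => (k < l)%N && (sigma l < sigma k)%N)).
  by apply: eq_bigr => k _; apply: eq_bigr => l _; rewrite !permKV.
pose q1 (k l : 'I_N) : nat := (l < n k)%N.
have -> : (\sum_(k < N) a (sigma k) * (\sum_(l < N | (l < k)%N) a l) = psum q1)%N.
  rewrite -(sum2_perml (fun k l : 'I_N => (l < k)%N)) -(sum_cond (fun k l : 'I_N => (l < k)%N)).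
  by apply: eq_bigr => k _; rewrite big_distrr.
pose q2 (k l : 'I_N) : nat := (l == k).
(* Each [a k] is 0 or 1, hence equal to its square: a linear form is a diagonal quadratic form. *)
have q2E (P : 'I_N -> bool) : (\sum_(k < N | P k) a k = psum (fun k l => P k * (l == k)))%N.
  rewrite -(sum_diag id) big_mkcond; apply: eq_bigr => k _ /=.
  by case: (P k); case: (a k).
have -> : (\sum_(k < N) a k = psum q2)%N.
  by rewrite q2E; apply: eq_bigr => k _; apply: eq_bigr => l _; rewrite mul1n.
rewrite q2E.
pose q3 (k l : 'I_N) : nat := (k < l)%N.
have -> : (\sum_(k < N) \sum_(l < N | (k < l)%N) a k * a l = psum q3)%N.
  exact: (sum_cond (fun k l : 'I_N => (k < l)%N)).
rewrite (sum_cond (fun k l : 'I_N => (k < l)%N)).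
rewrite (sum_cond (fun k l : 'I_N => (k < l)%N && (pos l < pos k)%N)).
rewrite !sum_pair_degrees.
pose tw (k l : 'I_N) : nat := ((l == n k) + (l == k))%N.
have -> : (\sum_(k < N) a k * (a (sigma k) + a k) = psum tw)%N.
  have pick j k : (\sum_l (l == j) * (a k * a l) = a k * a j)%N.
    by rewrite (bigD1 j) //= big1 ?eqxx ?addn0 ?mul1n // => l /negPf ->.
  under eq_bigr do rewrite mulnDr.
  rewrite big_split /= (sum_perm (fun k k' => a k * a k')%N) -big_split /=.
  apply: eq_bigr => k _; rewrite mulnC -!pick -big_split /=.
  by apply: eq_bigr => l _; rewrite mulnDl.
(* Two numbers have the same parity when their sum is even; this leaves one quadratic form to
   study. *)
apply/eqP; rewrite -[_ == _]negbK negb_eqb -oddD -!big_split /=.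
under eq_bigr do rewrite -!big_split /=.
(* These facts express all comparisons by few booleans and exclude the contradictory cases, so that
   a finite check remains. *)
have ltC (i j : 'I_N) : (j < i)%N = ~~ ((i == j) || (i < j)%N) by rewrite ltnNge leq_eqVlt.
have posC i j : (pos j < pos i)%N = ~~ ((i == j) || (pos i < pos j)%N).
  by rewrite ltnNge leq_eqVlt (inj_eq pos_inj).
have ltE (i j : 'I_N) : ~~ ((i == j) && (i < j)%N).
  by apply/negP => /andP[/eqP ->]; rewrite ltnn.
have posE i j : ~~ ((i == j) && (pos i < pos j)%N).
  by apply/negP => /andP[/eqP ->]; rewrite ltnn.
apply: even_pair_sum => [k|k l kl].
  rewrite /g /q1 /q2 /q3 /tw; rewrite !eqxx !ltnn [(pos _ <= pos _)%N]leq_eqVlt (inj_eq pos_inj).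
  rewrite (ltC (n k) k) (posC (n k) k) [k == n k]eq_sym.
  move: (ltE (n k) k) (posE (n k) k).
  by case: (n k == k); case: (n k < k)%N; case: (pos _ < pos _)%N; case: (a k).
have nkl : (k == l) = false by rewrite -val_eqE /= ltn_eqF.
have nlk : (l == k) = false by rewrite eq_sym.
have ninj : (n k == n l) = false by rewrite (inj_eq perm_inj).
(* This extends [pos_cycle] to both orders of [k] and [l]: exchanging them negates the comparison of
   [pos (n k)] with [pos (n l)], which the summand [pos l < pos k] makes up for. *)
have h : (pos (n k) < pos (n l))%N (+) (pos l < pos k)%N
    = (pos (n k) <= pos l)%N (+) (pos (n l) <= pos k)%N.
  have [kl'|lk] := boolP (pos k < pos l)%N.
    by rewrite (posC k) nkl kl' addbF pos_cycle.
  have lk' : (pos l < pos k)%N by rewrite posC nkl.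
  by rewrite lk' addbT (posC (n l)) eq_sym ninj negbK addbC -pos_cycle.
move: h; rewrite /g /q1 /q2 /q3 /tw nkl nlk kl.
rewrite [(pos (n k) <= pos l)%N]leq_eqVlt [(pos (n l) <= pos k)%N]leq_eqVlt !(inj_eq pos_inj).
rewrite (ltC k l) (ltC (n k) (n l)) (posC k l) (posC (n k) (n l)) nkl ninj kl.
rewrite (ltC (n k) l) (posC (n k) l) (ltC (n l) k) (posC (n l) k) [l == n k]eq_sym [k == n l]eq_sym.
move: (ltE (n k) l) (posE (n k) l) (ltE (n l) k) (posE (n l) k).
case: (n k == l); case: (n l == k); case: (n k < l)%N; case: (pos (n k) < pos l)%N => //;
case: (n l < k)%N; case: (pos (n l) < pos k)%N => //;
case: (n k < n l)%N; case: (pos (n k) < pos (n l))%N; case: (pos k < pos l)%N => //;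
by case: (a k); case: (a l); case: (_ <= _)%N; case: (_ <= _)%N.
Qed.
End Parity.

(** * The Koszul sign of sorting a product *)

Section Reorder.
Variables (C : comNzRingType) (N : nat).
Variables (B : 'I_N -> grassmann C) (b : 'I_N -> bool).
Hypothesis ghomB : forall k, ghom (b k) (B k).

(** As [r] is increasing, [B x] has to pass precisely the factors of smaller index to reach its
    place. *)
Lemma prod_insert (r : seq 'I_N) (P : pred 'I_N) x :
  sorted ltn (map val r) -> x \in r -> ~~ P x ->
  B x * \prod_(k <- r | P k) B k =
  (-1) ^+ (\sum_(y <- r | P y && (y < x)%N) b x * b y)%N *
  \prod_(k <- r | P k || (k == x)) B k.
Proof.
elim: r => //= y r IH; rewrite (path_sortedE ltn_trans) => /andP[/allP yr sr].
have {}yr k : k \in r -> (y < k)%N by move=> kr; apply/yr/map_f.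
rewrite inE !big_cons; have [->|nxy /=] := eqVneq x y => [_|xr] Px.
  rewrite (negPf Px) ltnn /= (_ : (\sum_(j <- r | _) _)%N = 0%N) ?mul1r.
    congr (_ * _); rewrite big_seq_cond [RHS]big_seq_cond.
    apply: eq_bigl => k; case kr: (k \in r) => //=.
    by rewrite -val_eqE gtn_eqF ?orbF // yr.
  rewrite big_seq_cond big_pred0 // => k; case kr: (k \in r) => //=.
  by rewrite (leq_gtF (ltnW (yr k kr))) andbF.
rewrite yr // andbT orbF.
case: (P y); last exact: IH.
rewrite mulrA (gmulC (ghomB y) (ghomB x)) -mulrA -mulrA IH // mulnC exprD -!mulrA.
by congr (_ * _); rewrite mulrA (commr_sign (B y)) mulrA.
Qed.

(** Insertion sort: the tail is sorted by induction, then the head is inserted. The filter on the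
    right allows lists that do not contain every index. *)
Lemma prod_reorder_filter (s : seq 'I_N) : uniq s ->
  \prod_(k <- s) B k =
  (-1) ^+ (\sum_(k <- s) \sum_(l <- s | (k < l)%N && (index l s < index k s)%N)
             b k * b l)%N
  * \prod_(k <- enum 'I_N | k \in s) B k.
Proof.
have sN : sorted ltn (map val (enum 'I_N)) by rewrite val_enum_ord iota_ltn_sorted.
elim: s => [_|x s IH /= /andP[xs us]].
  by rewrite !big_nil big_pred0_eq mul1r.
rewrite big_cons IH // mulrA commr_sign -mulrA (prod_insert sN) ?mem_enum // mulrA -exprD.
congr (_ ^+ _ * _); last by apply: eq_bigl => k; rewrite inE orbC.
(* The head [x] has index 0: it is never the first member of an inverted pair, and it is the second
   one for every [k < x] of the tail, which are the pairs counted by [prod_insert]. *)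
rewrite big_cons [X in (_ = X + _)%N]big_pred0 ?add0n => [|l]; last by rewrite eqxx ltn0 andbF.
rewrite [X in (_ + X)%N]big_enum_cond /= big_mkcondr -big_uniq // addnC -big_split /=.
rewrite big_seq [RHS]big_seq; apply: eq_bigr => k ks.
have nxk y : y \in s -> (x == y) = false by move=> ys; apply: contraNF xs => /eqP ->.
rewrite big_cons eqxx nxk // ltnS leq0n andbT mulnC.
rewrite (_ : (\sum_(l <- s | _) _) = \sum_(l <- s |
   (k < l)%N && ((if x == l then 0 else (index l s).+1) < (index k s).+1)%N) b k * b l)%N; last first.
  rewrite big_seq_cond [RHS]big_seq_cond; apply: eq_bigl => l.
  by case ls: (l \in s); rewrite //= nxk.
by case: ifP.
Qed.

Lemma prod_reorder (s : seq 'I_N) : uniq s -> (forall k, k \in s) ->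
  \prod_(k <- s) B k =
  (-1) ^+ (\sum_(k < N) \sum_(l < N | (k < l)%N && (index l s < index k s)%N)
             b k * b l)%N
  * \prod_(k < N) B k.
Proof.
move=> us sN.
have ps : perm_eq s (index_enum 'I_N).
  by apply: uniq_perm; rewrite ?index_enum_uniq // => k; rewrite sN mem_index_enum.
rewrite prod_reorder_filter // (perm_big _ ps); congr (_ ^+ _ * _).
  by apply: eq_bigr => k _; rewrite (perm_big _ ps).
by rewrite [index_enum _]unlock -enumT; apply: eq_bigl => k; rewrite sN.
Qed.
End Reorder.

(** * Positions in a concatenation of cycles *)

Section Cycles.
Variables (T : finType) (f : T -> T).

Lemma fcycle_closed c x : fcycle f c -> x \in c -> f x \in c.
Proof. by move=> cc xc; rewrite (eqP (next_cycle cc xc)) mem_next. Qed.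

Lemma index_next_fcycle c k : uniq c -> fcycle f c -> k \in c ->
  index (f k) c = (if (index k c).+1 == size c then 0 else (index k c).+1)%N.
Proof.
move=> uc hc kc; rewrite (eqP (next_cycle hc kc)) next_nth kc.
case: c uc kc {hc} => // y c uc kc; rewrite [size _]/= eqSS.
(* After the last element, [nth] runs out of range and returns its default [y], the head of the
   cycle. *)
have [->|ne] := eqVneq; first by rewrite nth_default //= eqxx.
rewrite -[nth y c _]/(nth y (y :: c) (index k (y :: c)).+1) index_uniq //=.
have : (index k (y :: c) < size (y :: c))%N by rewrite index_mem.
by rewrite /= !ltnS leq_eqVlt (negPf ne).
Qed.

Lemma fcycles_closed cs x :
  all (fcycle f) cs -> x \in flatten cs -> f x \in flatten cs.
Proof.
move=> /allP h /flattenP[c cin xc]; apply/flattenP; exists c => //.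
exact: fcycle_closed (h c cin) xc.
Qed.

(* The successor of the last element l of a cycle is its first element. *)
Lemma index_next_cycles cs l : uniq (flatten cs) -> all (fcycle f) cs ->
  l \in flatten cs ->
  let pos := index^~ (flatten cs) in
  pos (f l) = (pos l).+1 \/
  [/\ (pos (f l) <= pos l)%N,
      forall k, (pos (f l) <= pos k < pos l)%N -> pos (f k) = (pos k).+1 &
      forall k, (pos k < pos (f l))%N -> (pos (f k) < pos (f l))%N].
Proof.
move=> us hcs; elim: cs us hcs => //= c cs IH; rewrite cat_uniq => /and3P[uc dc us] /andP[hc hcs].
have indexc k : k \in c -> index k (c ++ flatten cs) = index k c.
  by move=> kc; rewrite index_cat kc.
have indexcs k : k \in flatten cs -> index k (c ++ flatten cs) = (size c + index k (flatten cs))%N.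
  by move=> kcs; rewrite index_cat ifN //; apply: contra dc => kc; apply/hasP; exists k.
have fcs k : k \in flatten cs -> f k \in flatten cs by exact: fcycles_closed.
have [lc _|lc /= lcs] := boolP (l \in c).
  have flc := fcycle_closed hc lc; rewrite !indexc // index_next_fcycle //.
  (* If [l] ends the first cycle, [f l] has position 0, so the last clause is vacuous. *)
  case: eqP => [sz|_]; [right | by left].
  split=> // k; rewrite leq0n /= => kl.
  have kc : k \in c.
    apply: contraLR kl => kc; rewrite index_cat (negPf kc) -leqNgt.
    by apply: leq_trans (leq_addr _ _); rewrite ltnW // index_mem.
  rewrite !indexc ?fcycle_closed // in kl *; rewrite index_next_fcycle // ifN //.
  by rewrite -sz eqSS ltn_eqF.
rewrite mem_cat (negPf lc) /= in lcs.
have bound k (i : nat) : k \notin c -> (i <= size (flatten cs))%N ->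
    (index k (c ++ flatten cs) < size c + i)%N -> k \in flatten cs.
  move=> kc hi; rewrite index_cat (negPf kc) ltn_add2l => h.
  by rewrite -index_mem (leq_trans h).
have small k j : k \in c -> (index k (c ++ flatten cs) < size c + j)%N.
  by move=> kc; rewrite indexc // (leq_trans _ (leq_addr _ _)) // index_mem.
rewrite !(indexcs _ lcs) !(indexcs _ (fcs _ lcs)).
(* Behind the first cycle all positions are shifted by [size c]; the elements of [c] and their
   images precede [f l]. *)
case: (IH us hcs lcs) => [->|[h1 h2 h3]]; [by left; rewrite addnS | right].
split=> [|k|k]; first by rewrite leq_add2l.
  move=> /andP[kl lk].
  have kc : k \notin c.
    by apply: contraL kl => kc; rewrite -ltnNge small.
  have kcs := bound k _ kc (index_size _ _) lk.
  rewrite !indexcs ?fcs // ?leq_add2l ?ltn_add2l in kl lk *.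
  by rewrite h2 ?kl // addnS.
have [kc _|kc lk] := boolP (k \in c); first by rewrite small // fcycle_closed.
have kcs := bound k _ kc (index_size _ _) lk.
by rewrite !indexcs ?fcs // !ltn_add2l in lk *; apply: h3.
Qed.

(** The successor [f k] stands no later than [k] exactly when [k] is the last element of its cycle;
    1-cycles are covered since equality is allowed. *)
Lemma sum_cycle_descents cs (G : T -> nat) :
  uniq (flatten cs) -> all (fcycle f) cs -> (forall k, k \in flatten cs) ->
  let pos := index^~ (flatten cs) in
  (\sum_(k | (pos (f k) <= pos k)%N) G k
   = \sum_(c <- cs) if c is x :: p then G (last x p) else 0)%N.
Proof.
move=> us hcs sT pos.
have -> : (\sum_(k | (pos (f k) <= pos k)%N) G k
    = \sum_(k <- flatten cs | (pos (f k) <= pos k)%N) G k)%N.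
  apply: perm_big; apply: uniq_perm; rewrite ?index_enum_uniq // => k.
  by rewrite sT mem_index_enum.
rewrite {}/pos {sT}; elim: cs us hcs => [|c cs IH] /=; first by rewrite !big_nil.
rewrite cat_uniq => /and3P[uc dc us] /andP[hc hcs].
rewrite big_cat big_cons /= -(IH us hcs); congr (_ + _)%N; last first.
  rewrite [LHS]big_seq_cond [RHS]big_seq_cond; apply: eq_bigl => k.
  case kcs: (k \in flatten cs) => //=.
  have notc z : z \in flatten cs -> (z \in c) = false.
    by move=> zcs; apply: contraNF dc => zc; apply/hasP; exists z.
  by rewrite !index_cat !notc ?fcycles_closed // leq_add2l.
rewrite [LHS]big_seq_cond (eq_bigl (fun k => (k \in c) && (index k c == (size c).-1))); last first.
  move=> k; case kc: (k \in c) => //=.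
  rewrite !index_cat kc fcycle_closed // index_next_fcycle //.
  have : (index k c < size c)%N by rewrite index_mem.
  case: (size c) => // sz; rewrite eqSS ltnS /=.
  by case: eqP => // _; rewrite ltnn.
case: c uc {hc dc} => [|x p] uc; first by rewrite big_nil.
rewrite -big_filter (_ : [seq _ <- _ | _] = [:: last x p]) ?big_seq1 //.
have lx : last x p \in x :: p by exact: mem_last.
rewrite -[RHS](filter_pred1_uniq uc lx); apply: eq_in_filter => k kc.
rewrite kc; have el : index (last x p) (x :: p) = size p by exact: index_last.
apply/eqP/eqP => [ek|->//]; have := nth_index x kc.
by rewrite ek [(size _).-1]/= -el nth_index.
Qed.
End Cycles.

(** * Sums over partial index assignments *)

Section AgreeOff.
Variables (T I : finType).
Implicit Types (s : seq T) (r : {ffun T -> I}).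

(* Sums over the partial index assignments s -> I, each represented by its
   extension by r0. *)
Definition agree_off s r0 : pred {ffun T -> I} :=
  fun r => [forall k, (k \notin s) ==> (r k == r0 k)].

Lemma agree_offP s r0 r :
  reflect (forall k, k \notin s -> r k = r0 k) (agree_off s r0 r).
Proof.
apply: (iffP forallP) => h k; last by apply/implyP => /h/eqP.
by move=> ks; apply/eqP/(implyP (h k)).
Qed.

Lemma eq_agree_off s1 s2 r0 : s1 =i s2 -> agree_off s1 r0 =1 agree_off s2 r0.
Proof. by move=> e r; apply: eq_forallb => k; rewrite e. Qed.

Definition ffun_upd r0 (k : T) (x : I) : {ffun T -> I} :=
  [ffun j => if j == k then x else r0 j].

Variable V : nmodType.
Implicit Type F : {ffun T -> I} -> V.

Lemma sum_agree_nil r0 F : \sum_(r | agree_off [::] r0 r) F r = F r0.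
Proof.
apply: big_pred1 => r; apply/agree_offP/eqP => [h|-> //].
by apply/ffunP => k; apply: h.
Qed.

Lemma sum_agree1 r0 k F :
  \sum_(r | agree_off [:: k] r0 r) F r = \sum_x F (ffun_upd r0 k x).
Proof.
rewrite (partition_big (fun r => r k) xpredT) //=; apply: eq_bigr => x _.
apply: big_pred1 => r; apply/andP/eqP => [[/agree_offP h /eqP <-]|->]; last first.
  rewrite ffunE !eqxx; split=> //; apply/agree_offP => j.
  by rewrite inE ffunE => /negPf ->.
apply/ffunP => j; rewrite ffunE; case: eqP => [->//|/eqP jk].
by apply: h; rewrite inE.
Qed.

Lemma sum_agree_cat s1 s2 r0 F : uniq (s1 ++ s2) ->
  \sum_(r | agree_off (s1 ++ s2) r0 r) F r =
  \sum_(r1 | agree_off s1 r0 r1) \sum_(r | agree_off s2 r1 r) F r.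
Proof.
rewrite cat_uniq => /and3P[_ /hasPn d _].
(* Resetting [r] to [r0] on [s2] recovers the intermediate assignment [r1], so the fibres of [h] are
   the inner sums. *)
pose h r : {ffun T -> I} := [ffun k => if k \in s2 then r0 k else r k].
rewrite (partition_big h (agree_off s1 r0)) => [|r /agree_offP hr].
  apply: eq_bigr => r1 /agree_offP h1; apply: eq_bigl => r.
  apply/andP/agree_offP => [[/agree_offP hr /eqP <-] k ks2|hr].
    by rewrite ffunE (negPf ks2).
  split; first by apply/agree_offP => k; rewrite mem_cat => /norP[k1 k2]; rewrite hr ?h1.
  apply/eqP/ffunP => k; rewrite ffunE; case: ifP => [k2|/negbT k2]; last exact: hr.
  by rewrite h1 //; apply: d.
apply/agree_offP => k k1; rewrite ffunE; case: ifP => // /negbT k2.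
by apply: hr; rewrite mem_cat negb_or k1.
Qed.

Lemma sum_agree_cons k s r0 F : uniq (k :: s) ->
  \sum_(r | agree_off (k :: s) r0 r) F r =
  \sum_x \sum_(r | agree_off s (ffun_upd r0 k x) r) F r.
Proof.
by move=> us; rewrite -cat1s sum_agree_cat // sum_agree1.
Qed.

Lemma agree_upd k s r0 x r : k \notin s -> agree_off s (ffun_upd r0 k x) r -> r k = x.
Proof. by move=> ks /agree_offP/(_ k ks); rewrite ffunE eqxx. Qed.

End AgreeOff.

Definition local_on (T I : finType) (Y : Type) (s : seq T) (F : {ffun T -> I} -> Y) :=
  forall r r' : {ffun T -> I}, (forall k, k \in s -> r k = r' k) -> F r = F r'.

(** Distributivity over disjoint blocks, with the order of the factors kept. The base [r1] varies
    because the later blocks extend the assignment chosen on the earlier ones. *)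
Lemma prod_sum_agree (T I : finType) (V : pzSemiRingType) (cs : seq (seq T))
    (F : seq T -> {ffun T -> I} -> V) (G : seq T -> V) r0 :
  uniq (flatten cs) -> (forall c, c \in cs -> local_on c (F c)) ->
  (forall c r1, c \in cs -> G c = \sum_(r | agree_off c r1 r) F c r) ->
  \prod_(c <- cs) G c =
  \sum_(r | agree_off (flatten cs) r0 r) \prod_(c <- cs) F c r.
Proof.
elim: cs r0 => [|c cs IH] r0 us loc hG.
  by rewrite big_nil sum_agree_nil big_nil.
rewrite big_cons [flatten _]/= sum_agree_cat //.
move: us; rewrite [flatten _]/= cat_uniq => /and3P[uc /hasPn d us].
rewrite (hG c r0) ?mem_head // mulr_suml; apply: eq_bigr => r1 _.
rewrite (IH r1) // => [|c' c'cs|c' r2 c'cs]; first last.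
- by apply: hG; rewrite inE c'cs orbT.
- by apply: loc; rewrite inE c'cs orbT.
rewrite mulr_sumr; apply: eq_bigr => r /agree_offP hr; rewrite big_cons.
congr (_ * _); apply: loc; first exact: mem_head.
by move=> k kc; rewrite hr //; apply: contraL kc => /d.
Qed.

(** * Supertraces of matrix products as sums over index assignments *)

Section Traces.
Variables (C : comNzRingType) (m n : nat) (T : finType).
Variable A : T -> 'M[grassmann C]_(m + n).
Local Notation I := 'I_(m + n).

(** A summand of a row-[i] entry of the product of the [A k] along [c]: [r k] is the column index of
    [A k] and the row index of the next factor. *)
Fixpoint path_entries (i : I) (c : seq T) (r : {ffun T -> I}) : grassmann C :=
  if c is k :: c' then A k i (r k) * path_entries (r k) c' r else 1.

Lemma path_entries_rcons i c k r :
  path_entries i (rcons c k) r =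
  path_entries i c r * A k (last i [seq r j | j <- c]) (r k).
Proof.
elim: c i => [|j c IH] i /=; first by rewrite mul1r mulr1.
by rewrite IH mulrA.
Qed.

Lemma path_entries_local i c : local_on c (path_entries i c).
Proof.
elim: c i => //= k c IH i r r' h; rewrite h ?mem_head //; congr (_ * _).
by apply: IH => j jc; rewrite h // inE jc orbT.
Qed.

(** The weight [G] on the final column index leaves room for the factor that closes a cycle. *)
Lemma prod_mx_path_entries c (i : I) (G : I -> grassmann C) r0 : uniq c ->
  \sum_j (\prod_(k <- c) A k) i j * G j =
  \sum_(r | agree_off c r0 r) path_entries i c r * G (last i [seq r k | k <- c]).
Proof.
elim: c i r0 => [|k c IH] i r0 uc.
  rewrite sum_agree_nil big_nil mul1r (bigD1 i) //= big1 => [|j ji].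
    by rewrite mxE eqxx mul1r addr0.
  by rewrite mxE eq_sym (negPf ji) mul0r.
rewrite sum_agree_cons //; case/andP: uc => kc uc.
under [LHS]eq_bigr do rewrite big_cons -mulmxE mxE mulr_suml.
rewrite exchange_big /=; apply: eq_bigr => x _.
under eq_bigr do rewrite -mulrA.
rewrite -mulr_sumr (IH _ (ffun_upd r0 k x)) // mulr_sumr.
by apply: eq_bigr => r /(agree_upd kc) ->; rewrite mulrA.
Qed.

Lemma End_homogeneous_prod c :
  (forall k, End_homogeneous false (A k)) ->
  End_homogeneous false (\prod_(k <- c) A k).
Proof.
move=> hA; have hom k i j : ghom (vparity i (+) vparity j) (A k i j).
  by have /forallP/(_ i)/forallP/(_ j) := hA k.
elim: c => [|k c IH].
  rewrite big_nil; apply/forallP => i; apply/forallP => j; rewrite mxE.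
  by case: eqP => [->|_]; rewrite ?addbb ?ghom1 ?ghom0.
rewrite big_cons -mulmxE; apply/forallP => i; apply/forallP => j; rewrite mxE.
apply: ghom_sum => x _.
have -> : false (+) vparity i (+) vparity j
    = (vparity i (+) vparity x) (+) (false (+) vparity x (+) vparity j).
  by case: (vparity i); case: (vparity j); case: (vparity x).
apply: ghomM => //.
by move/forallP/(_ x)/forallP/(_ j): IH.
Qed.

Lemma supertrace_even (B : 'M[grassmann C]_(m + n)) : End_homogeneous false B ->
  supertrace B = \sum_l (-1) ^+ vparity l * B l l.
Proof.
move=> hB; apply: eq_bigr => l _; have /forallP/(_ l)/forallP/(_ l) := hB.
by rewrite addFb addbb => h; rewrite (gtwist_hom _ h) muln0 mul1r.
Qed.

(** The path is closed by taking the column index of the last factor as the first row index; the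
    sign is that of the supertrace. *)
Definition cycle_term (c : seq T) (r : {ffun T -> I}) : grassmann C :=
  if c is x :: c' then
    (-1) ^+ vparity (r (last x c')) * path_entries (r (last x c')) c r
  else 0.

Lemma cycle_term_local c : local_on c (cycle_term c).
Proof.
case: c => // x c r r' h; rewrite /cycle_term (h _ (mem_last x c)).
by congr (_ * _); apply: path_entries_local.
Qed.

Lemma supertrace_cycle c r0 :
  (forall k, End_homogeneous false (A k)) -> uniq c -> c != [::] ->
  supertrace (\prod_(k <- c) A k) = \sum_(r | agree_off c r0 r) cycle_term c r.
Proof.
move=> hA; rewrite (supertrace_even (End_homogeneous_prod c hA)).
case/lastP: c => // c z uc _.
have uzc : uniq (z :: c) by move: uc; rewrite rcons_uniq.
(* The diagonal index of the supertrace is the one assigned to the last factor [z]; listing [z]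
   first makes its sum the outermost. *)
rewrite (eq_bigl _ _ (eq_agree_off r0 (s2 := z :: c) _)); last first.
  by move=> k; rewrite mem_rcons.
have termE r : cycle_term (rcons c z) r =
    (-1) ^+ vparity (r z) * path_entries (r z) (rcons c z) r.
  by case: c {uc uzc} => //= x c; rewrite last_rcons.
under [RHS]eq_bigr do rewrite termE.
rewrite sum_agree_cons //; apply: eq_bigr => l _.
rewrite -cats1 big_cat big_seq1 /= -mulmxE mxE.
case/andP: uzc => zc uc'.
rewrite (prod_mx_path_entries _ (fun j => A z j l) (ffun_upd r0 z l)) // mulr_sumr.
by apply: eq_bigr => r /(agree_upd zc) e; rewrite cats1 path_entries_rcons e.
Qed.

(** Along an [f]-path the predecessor of [k] is [g k], whose column index is the row index of [A k].
    For [f] the inverse of [sigma] this row index is [r (sigma k)], as in the picture invariant. *)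
Lemma path_entries_fcycle (f g : T -> T) z c (r : {ffun T -> I}) : cancel f g ->
  fpath f z c -> path_entries (r z) c r = \prod_(k <- c) A k (r (g k)) (r k).
Proof.
move=> fK; elim: c z => [|k c IH] z /=; first by rewrite big_nil.
by move=> /andP[/eqP <- /IH ->]; rewrite big_cons fK.
Qed.

End Traces.

(** * Auxiliary facts on integer multiples and products *)

Lemma ffun_Mz (T : finType) (V : zmodType) (F : {ffun T -> V}) (z : int) x :
  (F *~ z) x = F x *~ z.
Proof. by case: z => k; rewrite ?NegzE ?mulrNz ?ffunE -pmulrn ffunMnE. Qed.

Lemma prod_zero_factor (V : pzSemiRingType) (T : eqType) (s : seq T) (F : T -> V) k :
  k \in s -> F k = 0 -> \prod_(j <- s) F j = 0.
Proof.
move=> + Fk; elim: s => // j s IH; rewrite inE big_cons => /predU1P[<-|/IH ->].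
  by rewrite Fk mul0r.
by rewrite mulr0.
Qed.

Lemma prod_sign (C : comNzRingType) (I : Type) (s : seq I) (e : I -> nat)
    (G : I -> grassmann C) :
  \prod_(i <- s) ((-1) ^+ e i * G i) = (-1) ^+ (\sum_(i <- s) e i)%N * \prod_(i <- s) G i.
Proof.
elim: s => [|i s IH]; first by rewrite !big_nil mulr1.
by rewrite !big_cons IH exprD -!mulrA; congr (_ * _); rewrite mulrA (commr_sign (G i)) mulrA.
Qed.

Lemma prod_flatten (V : pzSemiRingType) (T : Type) (ss : seq (seq T)) (F : T -> V) :
  \prod_(k <- flatten ss) F k = \prod_(s <- ss) \prod_(k <- s) F k.
Proof. by elim: ss => [|s ss IH] /=; rewrite ?big_nil // big_cat big_cons IH. Qed.

(** * Multidegree and restitution of the picture invariants *)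

Section Main.
Variables (C : comNzRingType) (m n s : nat) (md : 'I_s -> nat).
Local Notation N := (\sum_(i < s) md i)%N.
Variable sigma : 'S_N.
Local Notation I := 'I_(m + n).

Lemma card_block i : #|[set k : 'I_N | block k == i]| = md i.
Proof.
have inj : injective (@tagnat.Rank _ md i).
  move=> j j' /(congr1 val)/eqP; rewrite tagnat.eq_Rank eqxx => /eqP e.
  exact: val_inj.
rewrite -[RHS]card_ord -cardsT -(card_imset _ inj); apply: eq_card => k.
rewrite inE; apply/eqP/imsetP => [<-|[j _ ->]]; last exact: tagnat.Rank1K.
by exists (tagnat.sig2 k); rewrite ?inE ?tagnat.sig2K.
Qed.

Definition picture_lift : tpower C (Windex m n s) N :=
  \sum_(r : {ffun 'I_N -> I})
    dual_tensor (@Wparity m n s) (fun k => Tdual C (block k) (r (sigma k)) (r k))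
    *~ (picture_gamma sigma r * (-1) ^+ picture_q sigma r).

Lemma varpi_picture_lift :
  varpi (@Wparity m n s) picture_lift = picture_invariant C m n sigma.
Proof. by rewrite raddf_sum; apply: eq_bigr => r _; rewrite raddfMz. Qed.

Lemma dual_apply_Tdual i l j (w : supermatrix_sum C m n s) :
  dual_apply (Tdual C i l j) (Wcoords w) = gtwist (vparity j) (w i l j).
Proof.
rewrite /dual_apply (bigD1 (i, l, j)) //= big1 => [|y ny].
  by rewrite !ffunE eqxx mul1r addr0.
by rewrite ffunE (negPf ny) mul0r.
Qed.

Lemma dual_tensor_Tdual_neq0 (l j : 'I_N -> I) (x : {ffun 'I_N -> Windex m n s}) :
  dual_tensor (@Wparity m n s) (fun k => Tdual C (block k) (l k) (j k)) x != 0 ->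
  forall k, (x k).1.1 = block k.
Proof.
move=> h k; apply/eqP; apply: contraNT h => nk; rewrite ffunE.
rewrite (prod_zero_factor (k := k)) ?mem_index_enum // ffunE.
case: eqP => [e|_]; last exact: gtwist0.
by rewrite e eqxx in nk.
Qed.

(** In each word occurring in [picture_lift] the [k]-th letter belongs to the summand [block k], and
    [md i] of the blocks equal [i]. *)
Lemma picture_multidegree : multidegree md (picture_invariant C m n sigma).
Proof.
exists picture_lift; first exact: varpi_picture_lift.
move=> x hx i.
have hb k : (x k).1.1 = block k.
  apply/eqP; apply: contraNT hx => nk; rewrite sum_ffunE big1 // => r _.
  rewrite ffun_Mz (_ : dual_tensor _ _ x = 0) ?mul0rz //.
  apply/eqP; apply: contraNT nk => nz; apply/eqP.
  exact: dual_tensor_Tdual_neq0 nz k.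
by rewrite -[RHS]card_block; apply: eq_card => k; rewrite !inE hb.
Qed.

Variables (u : supermatrix_sum C m n s) (cs : seq (seq 'I_N)).
Hypotheses (u_even : W_homogeneous false u)
  (cs_sigma : cycle_decomposition (sigma^-1)%g cs).

Local Notation A := (fun k : 'I_N => u (block k)).
Local Notation a r := (fun k : 'I_N => vparity (r k)).
Local Notation B r := (fun k : 'I_N => A k (r (sigma k)) (r k)).

Lemma ghom_factor (r : {ffun 'I_N -> I}) k :
  ghom (a r (sigma k) (+) a r k) (B r k).
Proof.
have /forallP/(_ (block k))/forallP/(_ (r (sigma k)))/forallP/(_ (r k)) := u_even.
by [].
Qed.

(** The twists appear because the coordinates of [u] are twisted matrix entries. *)
Lemma restitution_picture :
  restitution (picture_invariant C m n sigma) (Wcoords u) =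
  \sum_(r : {ffun 'I_N -> I})
    (\prod_(k < N) gtwist (a r k) (B r k))
      *~ (picture_gamma sigma r * (-1) ^+ picture_q sigma r).
Proof.
have hw : homogeneous (@Wparity m n s) false (Wcoords u) by rewrite -W_homogeneousE.
rewrite -varpi_picture_lift restitution_varpi // -/(evr _ _ _) raddf_sum.
apply: eq_bigr => r _; rewrite raddfMz -[X in X *~ _ = _]/(ev _ _ _) (ev_tensor_even _ hw).
by rewrite (eq_bigr _ (fun k _ => dual_apply_Tdual _ _ _ u)).
Qed.

Lemma trace_monomial_sum (r0 : {ffun 'I_N -> I}) :
  trace_monomial cs A =
  \sum_(r : {ffun 'I_N -> I}) \prod_(c <- cs) cycle_term A c r.
Proof.
case: cs_sigma => us sN ns hc.
rewrite /trace_monomial (prod_sum_agree r0 (F := cycle_term A)) //.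
(* Every index occurs in some cycle, so the sum runs over all [r]. *)
- by apply: eq_bigl => r; apply/agree_offP => k; rewrite sN.
- by move=> c _; exact: cycle_term_local.
move=> c r1 cin; apply: supertrace_cycle => [k||].
- by move/forallP: u_even.
- by case/splitPr: cin us => ? ?; rewrite flatten_cat /= !cat_uniq => /and3P[_ _ /andP[]].
by apply: contraNneq ns => <-.
Qed.

(** The first sum is the Koszul exponent for sorting the concatenated cycles; the second collects
    the supertrace signs, attached to the last element of each cycle. *)
Lemma prod_cycle_term (r : {ffun 'I_N -> I}) :
  \prod_(c <- cs) cycle_term A c r =
  (-1) ^+ (\sum_(k < N) \sum_(l < N | (k < l)%N &&
              (index l (flatten cs) < index k (flatten cs))%N)
            (a r (sigma k) + a r k) * (a r (sigma l) + a r l)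
         + \sum_(k < N | (index ((sigma^-1)%g k) (flatten cs)
                          <= index k (flatten cs))%N) a r k)%N
  * \prod_(k < N) B r k.
Proof.
case: cs_sigma => us sN ns hc.
rewrite (sum_cycle_descents (a r)) //.
rewrite (eq_big_seq (fun c : seq 'I_N =>
    (-1) ^+ (if c is x :: p then a r (last x p) : nat else 0) * \prod_(k <- c) B r k)).
  rewrite prod_sign -prod_flatten (prod_reorder (ghom_factor r)) // mulrA -exprD.
  congr (_ * _); apply: signr_eq_odd; rewrite addnC !oddD; congr (_ (+) _).
  apply: odd_sum => k _; apply: odd_sum => l _.
  by rewrite !oddM !oddD !oddb.
move=> c cin; have /allP/(_ c cin) := hc.
case: c cin => [|x c] cin; first by rewrite cin in ns.
rewrite (cycle_path x) => hp; rewrite /cycle_term.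
by rewrite (path_entries_fcycle A r (permKV sigma) hp).
Qed.

Lemma picture_term (r : {ffun 'I_N -> I}) :
  (\prod_(k < N) gtwist (a r k) (B r k))
      *~ (picture_gamma sigma r * (-1) ^+ picture_q sigma r) =
  \prod_(c <- cs) cycle_term A c r.
Proof.
case: cs_sigma => us sN ns hc; rewrite prod_cycle_term.
pose tw (k : 'I_N) := (a r k * (a r (sigma k) + a r k))%N.
rewrite (eq_bigr (fun k => (-1) ^+ tw k * B r k)); last first.
  move=> k _; rewrite (gtwist_hom _ (ghom_factor r k)); congr (_ * _).
  by apply: signr_eq_odd; rewrite !oddM !oddD !oddb.
have gammaE : picture_gamma sigma r = (-1) ^+ (\sum_(k < N)
    \sum_(l < N | (k < l)%N && (sigma l < sigma k)%N) a r (sigma k) * a r (sigma l))%N.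
  rewrite /picture_gamma -prodrXr; apply: eq_bigr => k _; exact: prodrXr.
rewrite prod_signr -mulrzl gammaE -exprD rmorphXn rmorphN1 mulrA -exprD.
congr (_ * _); apply: signr_eq_odd.
apply: (picture_exponent_parity _ (pos := index^~ (flatten cs))).
  by move=> k l e; rewrite -(nth_index k (sN k)) e nth_index.
(* For [pos_cycle] there are three cases: the successor of [l] stands right after [l]; or [l] ends
   its cycle and [k] lies in it, so that the successor of [k] stands right after [k]; or [k] lies in
   an earlier cycle, as does its successor. *)
move=> k l kl.
have := index_next_cycles us hc (sN l).
move=> /= [-> |[nl_l nk_in nk_out]].
  by rewrite !ltnS [X in _ (+) X]leqNgt ltnS (ltnW kl) addbF.
have [nlk|knl] := leqP (index ((sigma^-1)%g l) (flatten cs)) (index k (flatten cs)).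
  by rewrite nk_in ?nlk // kl ltnNge (leq_trans nlk).
by rewrite nk_out // (leq_trans (ltnW (nk_out k knl))).
Qed.

Lemma restitution_picture_trace_monomial :
  restitution (picture_invariant C m n sigma) (Wcoords u) = trace_monomial cs A.
Proof.
rewrite restitution_picture.
(* There is no r at all when m + n = 0 < N; both sides then vanish. *)
have [r0 _|none] := pickP (@predT {ffun 'I_N -> I}).
  by rewrite (trace_monomial_sum r0); apply: eq_bigr => r _; exact: picture_term.
rewrite big_pred0 => [|r]; last by have := none r.
have I0 (i : I) : False by have := none [ffun=> i].
have [k _|N0] := pickP (@predT 'I_N); last first.
  have f (k : 'I_N) : I by have := N0 k.
  by have := none (finfun f).
case: cs_sigma => _ /(_ k) + _ _; rewrite /trace_monomial.
by case: cs => // c cs' _; rewrite big_cons [supertrace _]big_pred0 ?mul0r.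
Qed.

End Main.

Theorem corollary4p9 (R : realType) (m n s : nat) (md : 'I_s -> nat)
    (sigma : 'S_(\sum_(i < s) md i)) :
  multidegree md (picture_invariant R[i] m n sigma) /\
  forall (u : supermatrix_sum R[i] m n s)
         (cs : seq (seq 'I_(\sum_(i < s) md i))),
    W_homogeneous false u -> cycle_decomposition (sigma^-1)%g cs ->
    restitution (picture_invariant R[i] m n sigma) (Wcoords u) =
    trace_monomial cs (fun k => u (block k)).
Proof.
split=> [|u cs]; first exact: picture_multidegree.
exact: restitution_picture_trace_monomial.
Qed.
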